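(* Let $T>0$, $0<\nu<1$, let $k(x,t)$ and $f(x,t)$ be given sufficiently smooth functions with $0<c_1\le k(x,t)\le c_2$ and $k(x,t)=k(1-x,t)$ for all $(x,t)\in[0,1]\times[0,T]$, let $\mu\in C[0,T]$, and let $\alpha,\beta,\gamma$ be real numbers. Consider the nonlocal boundary value problem $$\partial_{0t}^{\nu}u=\frac{\partial}{\partial x}\left(k(x,t)\frac{\partial u}{\partial x}\right)+f(x,t),\quad 0<x<1,\ 0<t\le T,$$ $$u(0,t)=\alpha u(1,t),\qquad k(1,t)u_x(1,t)=\beta k(0,t)u_x(0,t)+\gamma u(1,t)+\mu(t),\quad 0\le t\le T,$$ $$u(x,0)=u_0(x),\quad 0\le x\le 1.$$ If the conditions $\alpha=\beta\neq 1$, $\gamma\le 0$ are satisfied, then the solution $u$ of this problem satisfies the estimate $$\|u\|_0^2+D_{0t}^{-\nu}\|u_x\|_0^2\le M\left(D_{0t}^{-\nu}\|f(x,t)\|_0^2+D_{0t}^{-\nu}\mu^2(t)+\|u_0(x)\|_0^2\right),$$ where $M>0$ is a known constant independent of $T$.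
   Context: Notation: $\partial_{0t}^{\nu}u(x,t)=\frac{1}{\Gamma(1-\nu)}\int_0^t u_\tau(x,\tau)(t-\tau)^{-\nu}\,d\tau$ is the Caputo fractional derivative of order $\nu$, $0<\nu<1$; $D_{0t}^{-\nu}w(t)=\frac{1}{\Gamma(\nu)}\int_0^t(t-s)^{\nu-1}w(s)\,ds$ is the Riemann--Liouville fractional integral of order $\nu$; $\|w\|_0^2=\int_0^1w^2(x,t)\,dx$ (a function of $t$ when $w$ depends on $t$). *)

(* Defs.v *)
From HB Require Import structures.
From mathcomp Require Import all_boot all_order all_algebra.
From mathcomp Require Import all_classical all_reals all_analysis.

Set Implicit Arguments.
Unset Strict Implicit.
Unset Printing Implicit Defensive.
Import Order.TTheory GRing.Theory Num.Theory.
Import numFieldNormedType.Exports.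

Local Open Scope classical_set_scope.
Local Open Scope ring_scope.

Definition Gamma (R : realType) (z : R) : R :=
  \int[lebesgue_measure]_(s in `]0, +oo[) (s `^ (z - 1) * expR (- s)).

(* Riemann-Liouville integral D_{0t}^{-nu} w *)
Definition rl_integral (R : realType) (nu : R) (w : R -> R) (t : R) : R :=
  (Gamma nu)^-1 *
  \int[lebesgue_measure]_(s in `]0, t[) ((t - s) `^ (nu - 1) * w s).

Definition caputo_integrand (R : realType) (nu : R) (g : R -> R) (t tau : R) : R :=
  derive1 g tau * (t - tau) `^ (- nu).

Definition caputo (R : realType) (nu : R) (g : R -> R) (t : R) : R :=
  (Gamma (1 - nu))^-1 *
  \int[lebesgue_measure]_(tau in `]0, t[) caputo_integrand nu g t tau.

(* squared L^2(0,1) norm *)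
Definition sqnorm0 (R : realType) (w : R -> R) : R :=
  \int[lebesgue_measure]_(x in `[0, 1]) w x ^+ 2.

(* Derivative relative to [0, 1]: one-sided at 0 and at 1, the usual derivative
   at interior points; values of g outside [0, 1] are irrelevant. *)
Definition diff_quot (R : realType) (g : R -> R) (x y : R) : R :=
  (g y - g x) / (y - x).

Definition derivable01 (R : realType) (g : R -> R) (x : R) : Prop :=
  cvg (diff_quot g x y @[y --> within `[0, 1]%classic (x^')]).

Definition derive01 (R : realType) (g : R -> R) (x : R) : R :=
  lim (diff_quot g x y @[y --> within `[0, 1]%classic (x^')]).

Definition pdx (R : realType) (u : R -> R -> R) (x t : R) : R :=
  derive01 (fun y => u y t) x.

Definition pdt (R : realType) (u : R -> R -> R) (x t : R) : R :=
  derive1 (u x) t.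

Definition continuous_on2 (R : realType) (D : set (R * R)) (u : R -> R -> R) : Prop :=
  {within D, continuous (fun p : R * R => u p.1 p.2)}.

Definition flux (R : realType) (k u : R -> R -> R) (t : R) : R -> R :=
  fun x => k x t * pdx u x t.

(* Regularity of a classical solution.  As usual for Caputo equations, u_t may
   be singular as t -> 0+ (typically like t^(nu - 1)); it is only asked to be
   dominated, uniformly in x, by an integrable function of t.  Every u in
   C^{2,1}([0, 1] x [0, T]) qualifies when k is in C^{1,0}. *)
Record classical_regularity (R : realType) (nu T : R) (k u : R -> R -> R) : Prop := {
  reg_cont : continuous_on2 (`[0, 1] `*` `[0, T]) u ;
  reg_dx : forall x t : R, 0 <= x <= 1 -> 0 <= t <= T ->
    derivable01 (fun y => u y t) x ;
  reg_dx_cont : continuous_on2 (`[0, 1] `*` `[0, T]) (pdx u) ;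
  reg_flux : forall x t : R, 0 < x < 1 -> 0 < t <= T ->
    derivable (flux k u t) x 1 ;
  reg_dt : forall x t : R, 0 <= x <= 1 -> 0 < t < T -> derivable (u x) t 1 ;
  reg_dt_cont : continuous_on2 (`[0, 1] `*` `]0, T[) (pdt u) ;
  reg_dt_dom : exists2 h : R -> R,
    lebesgue_measure.-integrable `]0, T[ (EFin \o h) &
    forall x t : R, 0 <= x <= 1 -> 0 < t < T -> `|pdt u x t| <= h t ;
  reg_caputo : forall x t : R, 0 < x < 1 -> 0 < t <= T ->
    lebesgue_measure.-integrable `]0, t[ (EFin \o caputo_integrand nu (u x) t)
}.

Record is_solution (R : realType) (nu T alpha beta gamma : R)
    (k f : R -> R -> R) (mu u0 : R -> R) (u : R -> R -> R) : Prop := {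
  sol_reg : classical_regularity nu T k u ;
  sol_eq : forall x t : R, 0 < x < 1 -> 0 < t <= T ->
    caputo nu (u x) t = derive1 (flux k u t) x + f x t ;
  sol_bc_value : forall t : R, 0 <= t <= T -> u 0 t = alpha * u 1 t ;
  sol_bc_flux : forall t : R, 0 <= t <= T ->
    k 1 t * pdx u 1 t = beta * (k 0 t * pdx u 0 t) + gamma * u 1 t + mu t ;
  sol_ic : forall x : R, 0 <= x <= 1 -> u x 0 = u0 x
}.

(* Main.v *)
Require Import Defs.
From HB Require Import structures.
From mathcomp Require Import all_boot all_order all_algebra.
From mathcomp Require Import all_classical all_reals all_analysis.
From mathcomp Require Import measurable_realfun.
From mathcomp Require Import lra ring.
Import Order.TTheory GRing.Theory Num.Theory.
Import numFieldNormedType.Exports.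
Local Open Scope classical_set_scope.
Local Open Scope ring_scope.

(** Write [B u] for the Caputo derivative.  Multiplying the equation by [u] and
    integrating by parts in [x], the boundary contribution is
    [gamma u(1)^2 + mu u(1)] because [alpha = beta]; since [alpha <> 1],
    [(1 - alpha) u(1)] is the integral of [u_x], so [u] is bounded pointwise by
    the L^1 norm of [u_x] and Young's inequality absorbs the lower-order terms.
    In time, [u B u >= B (u^2) / 2] pointwise (Alikhanov), and the
    Riemann-Liouville integral of [B (u^2)] is a positive multiple of
    [u(t)^2 - u(0)^2] by Fubini, because the convolution of the two Abel kernels
    is constant.  Only the positivity of that constant matters, so Euler's
    reflection formula is not needed. *)

(** No Gronwall argument occurs. Since [u] is controlled by [u_x] alone, no norm of [u] survives on
    the right after absorption, and every constant is built from [nu], [c1] and [alpha]; hence a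
    bound uniform in [T]. The obstacle is weak regularity: [u_t] may blow up at time 0 and only has
    an integrable majorant uniform in [x], and the flux is merely differentiable in [x]. So the
    squared norm is never differentiated in time: the time arguments run at fixed [x], on open
    intervals, and Fubini, justified by the majorant, carries them over to the norm. Continuity of
    the flux derivative, which integration by parts requires, is recovered from the equation once
    the Caputo derivative is known to be continuous in [x]. Real-valued integrals take a default
    value when the extended integral is infinite, so integrability has to accompany each identity
    and inequality. *)

Section affine.
Context {R : realType}.
Notation mu := (@lebesgue_measure R).

(** Lebesgue measure is [c] times its own pushforward under [x |-> a + c * x], by uniqueness on
    half-open intervals. Inside the proof [nu] is that scaled pushforward, not a fractional
    order. *)
Lemma ge0_integral_affine (a c : R) (f : R -> R) : 0 < c ->
  measurable_fun [set: R] f -> (forall x, 0 <= f x) ->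
  (\int[mu]_x (f x)%:E = c%:E * \int[mu]_x (f (a + c * x)%R)%:E)%E.
Proof.
move=> c0 mf f0.
pose phi : measurableTypeR R -> measurableTypeR R := fun x => a + c * x.
have mphi : measurable_fun setT phi.
  by apply: measurable_funD => //; exact: mulrl_measurable.
pose c' : {nonneg R} := NngNum (ltW c0).
pose pm0 := (pushforward mu phi : {measure set (measurableTypeR R) -> \bar R}).
pose pm := pm0 mphi.
pose nu := mscale c' pm.
have muE A : measurable A -> mu A = nu A.
  apply: lebesgue_measure_unique => _ [[x y] _ <-] /=.
  rewrite /nu /mscale/= /pm /pm0 /pushforward.
  have -> : phi @^-1` `]x, y] = `](x - a) / c, (y - a) / c]%classic.
    apply/seteqP; split => z /=; rewrite !in_itv/= /phi.
      by move=> /andP[h1 h2]; rewrite ltr_pdivrMr// ler_pdivlMr//; lra.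
    by rewrite ltr_pdivrMr// ler_pdivlMr// => /andP[h1 h2]; lra.
  rewrite !lebesgue_measure_itv/= !lte_fin.
  rewrite ltr_pM2r ?invr_gt0// ltrD2r; case: ifPn => _; last by rewrite mule0.
  by rewrite -!EFinB -EFinM; congr EFin; field; rewrite gt_eqF.
rewrite (eq_measure_integral nu)/=; last by move=> A mA _; exact: muE.
have mEf : measurable_fun setT (EFin \o f) by exact/measurable_EFinP.
rewrite /nu ge0_integral_mscale//; last by move=> x _; rewrite lee_fin.
congr (_ * _)%E.
by rewrite ge0_integral_pushforward// => x _; rewrite lee_fin.
Qed.

End affine.

(** * Fundamental theorem of calculus on open intervals, with endpoint singularities *)

Section ftc_open.
Context {R : realType}.
Notation mu := (@lebesgue_measure R).

Lemma subset_itv_oo_ccW (a b : R) : `]a, b[%classic `<=` `[a, b]%classic.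
Proof. by move=> x /=; exact: subset_itv_oo_cc. Qed.

(* One-sided fundamental theorem: [dF] itself need not be integrable. *)
Lemma le_Rintegral_oo_derive (F dF g : R -> R) (a b : R) : a <= b ->
  {within `[a, b], continuous F} ->
  (forall x, a < x < b -> is_derive x 1 F (dF x)) ->
  (forall x, a < x < b -> dF x <= g x) ->
  (forall x, a < x < b -> {for x, continuous g}) ->
  mu.-integrable `]a, b[ (EFin \o g) ->
  F b - F a <= \int[mu]_(x in `]a, b[) g x.
Proof.
rewrite le_eqVlt => /predU1P[-> *|ab cF dFE dFg cg ig].
  by rewrite subrr set_itv_ge ?bnd_simp// Rintegral_set0.
(* Extension by zero makes [g] integrable on the closed interval without changing it near any
   interior point, so its indefinite integral [G] is continuous up to the endpoints and has
   derivative [g] inside. *)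
pose g' := g \_ `]a, b[.
have ig' : mu.-integrable `[a, b] (EFin \o g').
  rewrite /g' -restrict_EFin; apply/integrable_restrict => //.
  by rewrite setIidr//; exact: subset_itv_oo_ccW.
pose G := parameterized_integral mu a ^~ g'.
have cG : {within `[a, b], continuous G}.
  by apply: parameterized_integral_continuous => //; exact: ltW.
have dG x : a < x < b -> is_derive x 1 G (g x).
  move=> /andP[ax xb].
  have xab : x \in `]a, b[ by rewrite in_itv/= ax xb.
  have g'x : g' x = g x by rewrite /g' patchE mem_set.
  have cg' : {for x, continuous g'}.
    rewrite /prop_for /continuous_at g'x.
    apply: cvg_trans (cg x _); last by rewrite ax xb.
    apply: near_eq_cvg; near=> y; rewrite /g' patchE mem_set//=.
    by near: y; exact: near_in_itvoo.
  have [dGx G'x] := continuous_FTC1_closed xb ig' ax cg'.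
  by apply: DeriveDef => //; rewrite -derive1E -g'x -G'x.
have dH x : x \in `]a, b[ -> is_derive x 1 (G - F) (g x - dF x).
  rewrite in_itv/= => abx; have ? := dG _ abx; have ? := dFE _ abx.
  exact: is_deriveB.
have cH : {within `[a, b], continuous (G - F)}.
  by move=> x; apply: cvgB; [exact: cG|exact: cF].
(* One mean value theorem for [G - F], whose derivative [g - dF] is nonnegative, gives the sign
   without ever integrating [dF]. *)
have [c cab E] := MVT ab dH cH.
have Gb : G b = \int[mu]_(x in `]a, b[) g x.
  rewrite /G /parameterized_integral /g' Rintegral_mkcond -patch_setI.
  rewrite setIidr; last exact: subset_itv_oo_ccW.
  by rewrite [RHS]Rintegral_mkcond.
have Ga : G a = 0 by rewrite /G /parameterized_integral set_itv1 Rintegral_set1.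
rewrite -subr_ge0 -Gb (_ : _ - _ = (g c - dF c) * (b - a)); last first.
  by rewrite -E !fctE Ga; ring.
by rewrite mulr_ge0 ?subr_ge0 ?dFg ?(ltW ab)//; move: cab; rewrite in_itv.
Unshelve. all: by end_near. Qed.

Lemma Rintegral_oo_derive (F g : R -> R) (a b : R) : a <= b ->
  {within `[a, b], continuous F} ->
  (forall x, a < x < b -> is_derive x 1 F (g x)) ->
  (forall x, a < x < b -> {for x, continuous g}) ->
  mu.-integrable `]a, b[ (EFin \o g) ->
  \int[mu]_(x in `]a, b[) g x = F b - F a.
Proof.
move=> ab cF dF cg ig; apply/eqP; rewrite eq_le; apply/andP; split; last first.
  exact: (@le_Rintegral_oo_derive F g).
have E : \int[mu]_(x in `]a, b[) (- g x) = - \int[mu]_(x in `]a, b[) g x.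
  rewrite -[RHS]mulN1r -RintegralZl//.
  by apply: eq_Rintegral => x _; rewrite mulN1r.
rewrite -lerN2 -E (_ : - (F b - F a) = (- F) b - (- F) a); last by rewrite !fctE; ring.
apply: (@le_Rintegral_oo_derive (- F) (- g) (- g)); [exact: ab| | | | |].
- by move=> x; apply: cvgN; exact: cF.
- by move=> x abx; have ? := dF x abx; exact: is_deriveN.
- by [].
- by move=> x abx; apply: continuousN; exact: cg.
- exact: integrableN ig.
Qed.

(** Integrability comes for free from the sign: on closed subintervals the integral is an increment
    of the nondecreasing [F], hence at most [F b - F a], and monotone convergence passes to the open
    interval. *)
Lemma ge0_integrable_oo_derive (F g : R -> R) (a b : R) :
  {within `[a, b], continuous F} ->
  (forall x, a < x < b -> is_derive x 1 F (g x)) ->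
  (forall x, a < x < b -> {for x, continuous g}) ->
  (forall x, a < x < b -> 0 <= g x) ->
  mu.-integrable `]a, b[ (EFin \o g).
Proof.
move=> cF dF cg g0.
have [ba|ab] := leP b a.
  by rewrite set_itv_ge -?leNgt ?bnd_simp//; exact: integrable_set0.
have mg : measurable_fun `]a, b[ (EFin \o g).
  apply/measurable_EFinP; apply: open_continuous_measurable_fun => // x.
  by rewrite inE/= in_itv/= => /cg.
have Fnd x y : a <= x -> x <= y -> y <= b -> F x <= F y.
  move=> ax; rewrite le_eqVlt => /predU1P[->//|xy] yb; rewrite -subr_ge0.
  have [| |c] := @MVT _ F g _ _ xy.
  - by move=> z; rewrite in_itv/= => /andP[? ?]; apply: dF; apply/andP; split; lra.
  - apply: continuous_subspaceW cF => z /=; rewrite !in_itv/= => /andP[? ?].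
    by apply/andP; split; lra.
  rewrite in_itv/= => /andP[? ?] ->; rewrite mulr_ge0 ?subr_ge0 ?(ltW xy)// g0//.
  by apply/andP; split; lra.
(* Starting at a third of the length keeps every [I n], the first included, nondegenerate. *)
pose h n : R := (b - a) / 3 * n.+1%:R^-1.
have h0 n : 0 < h n by rewrite mulr_gt0 ?divr_gt0 ?subr_gt0 ?invr_gt0.
have h1 n : h n <= (b - a) / 3.
  by rewrite ler_piMr ?divr_ge0 ?subr_ge0 ?(ltW ab)// invf_le1// ler1n.
pose I n : set R := `[a + h n, b - h n]%classic.
have IS n : I n `<=` `]a, b[.
  move=> x; rewrite /I/= !in_itv/= => /andP[? ?]; have := h0 n.
  by move=> ?; apply/andP; split; lra.
have Iint n : (\int[mu]_(x in I n) (g x)%:E <= (F b - F a)%:E)%E.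
  have abn : a + h n < b - h n by have := h1 n; lra.
  have abnP x : a + h n <= x <= b - h n -> a < x < b.
    by have := h0 n => ? /andP[? ?]; apply/andP; split; lra.
  have cFx x : a < x < b -> {for x, continuous F}.
    move=> xab; have [dFx _] := dF _ xab.
    by apply: differentiable_continuous; exact/derivable1_diffP.
  rewrite /I (continuous_FTC2 abn (F := F)).
  - rewrite -EFinB lee_fin lerB//; apply: Fnd => //; have := h0 n; lra.
  - apply: continuous_in_subspaceT => x; rewrite inE/= in_itv/= => /abnP.
    exact: cg.
  - split.
    + move=> x; rewrite in_itv/= => /andP[? ?].
      have /dF[] // : a < x < b by apply: abnP; apply/andP; split; lra.
    + by apply: cvg_at_right_filter; apply/cFx/abnP; rewrite lexx (ltW abn).
    + by apply: cvg_at_left_filter; apply/cFx/abnP; rewrite lexx (ltW abn).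
  - move=> x; rewrite in_itv/= => /andP[? ?].
    have /dF[_] : a < x < b by apply: abnP; apply/andP; split; lra.
    by rewrite derive1E.
have IU : \bigcup_n I n = `]a, b[%classic.
  apply/seteqP; split=> [x [n _ /IS//]|x/=]; rewrite in_itv/= => /andP[ax xb].
  pose e := Num.min (x - a) (b - x) / ((b - a) / 3).
  have e0 : 0 < e by rewrite divr_gt0// ?lt_min ?divr_gt0// ?subr_gt0// ax xb.
  have [N _ /(_ N (leqnn _))/= Ne] := near_infty_natSinv_lt (PosNum e0).
  exists N => //; rewrite /I/= in_itv/=.
  have : h N < Num.min (x - a) (b - x).
    by rewrite /h mulrC -ltr_pdivlMr// divr_gt0// subr_gt0.
  by rewrite lt_min => /andP[? ?]; apply/andP; split; lra.
apply/integrableP; split => //.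
rewrite (_ : (\int[mu]_(x in `]a, b[) _ = \int[mu]_(x in `]a, b[) (g x)%:E)%E);
  last first.
  apply: eq_integral => x; rewrite inE/= in_itv/= => xab.
  by rewrite /= ger0_norm// g0.
apply: (@le_lt_trans _ _ (F b - F a)%:E); last exact: ltry.
rewrite -IU.
have cI : (\int[mu]_(x in I i) (g x)%:E @[i --> \oo] -->
    \int[mu]_(x in \bigcup_i I i) (g x)%:E)%E.
  apply: ge0_nondecreasing_set_cvg_integral => //.
  - apply/nondecreasing_seqP => n; rewrite subsetEset => x; rewrite /I/= !in_itv/=.
    have : h n.+1 <= h n.
      by rewrite ler_pM2l ?divr_gt0 ?subr_gt0// lef_pV2 ?posrE// ler_nat.
    by move=> ? /andP[? ?]; apply/andP; split; lra.
  - by move=> n; exact: measurable_itv.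
  - by move=> i; apply: measurable_funS mg => //; exact: IS.
  - by move=> i x /IS; rewrite /= in_itv/= lee_fin; exact: g0.
rewrite -(cvg_lim _ cI)//; apply: lime_le; first by apply/cvg_ex; eexists; exact: cI.
by apply: nearW => n; exact: Iint.
Qed.

End ftc_open.

(** * Real powers, their integrability, and positivity of Gamma *)

Section powers.
Context {R : realType}.
Notation mu := (@lebesgue_measure R).

(** The truncation matters: [powR] equals 1 on negative reals, so the untruncated power jumps at
    0. *)
Lemma continuous_powR_max0 (q : R) : 0 < q ->
  continuous (fun y : R => Num.max 0 y `^ q).
Proof.
move=> q0 y.
have [y0|y0|->] := ltgtP y 0.
- rewrite /continuous_at max_l ?(ltW y0)//.
  apply: cvg_near_cst; near=> z; rewrite max_l//.
  by apply: ltW; near: z; exact: lt_nbhsl.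
- rewrite /continuous_at max_r ?(ltW y0)//.
  apply: (@cvg_trans _ (z `^ q @[z --> y])).
    apply: near_eq_cvg; near=> z; rewrite max_r//.
    by apply: ltW; near: z; exact: lt_nbhsr.
  have [+ _] := is_derive1_powR q y0.
  by move=> /derivable1_diffP/differentiable_continuous.
- apply/left_right_continuousP; rewrite maxxx powR0 ?gt_eqF//; split.
  + apply: cvg_near_cst; near=> z; rewrite max_l ?powR0 ?gt_eqF//.
  + apply: cvg_trans (powR_cvg0 q0); apply: near_eq_cvg; near=> z.
    by rewrite max_r.
Unshelve. all: by end_near. Qed.

Lemma within_continuous_eq (A : set R) (f g : R -> R) :
  continuous f -> {in A, f =1 g} -> {within A, continuous g}.
Proof.
move=> cf fg; apply: (@subspace_eq_continuous R A R f) => //.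
exact: continuous_subspaceT.
Qed.

Lemma within_continuous_powRBl (a b q : R) : 0 < q ->
  {within `[a, b], continuous (fun s : R => (s - a) `^ q)}.
Proof.
move=> q0; apply: (@within_continuous_eq _ (fun s => Num.max 0 (s - a) `^ q)); last first.
  by move=> s; rewrite inE/= in_itv/= => /andP[? ?]; rewrite max_r// subr_ge0.
move=> s; apply: (continuous_comp (f := fun s => s - a) (g := fun y => Num.max 0 y `^ q)); last exact: continuous_powR_max0.
by apply: cvgB; [exact: cvg_id|exact: cvg_cst].
Qed.

Lemma within_continuous_powRBr (a b q : R) : 0 < q ->
  {within `[a, b], continuous (fun s : R => (b - s) `^ q)}.
Proof.
move=> q0; apply: (@within_continuous_eq _ (fun s => Num.max 0 (b - s) `^ q)); last first.
  by move=> s; rewrite inE/= in_itv/= => /andP[? ?]; rewrite max_r// subr_ge0.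
move=> s; apply: (continuous_comp (f := fun s => b - s) (g := fun y => Num.max 0 y `^ q)); last exact: continuous_powR_max0.
by apply: cvgB; [exact: cvg_cst|exact: cvg_id].
Qed.

Lemma is_derive_powRBl (a q x : R) : a < x ->
  is_derive x 1 (fun s => (s - a) `^ q) (q * (x - a) `^ (q - 1)).
Proof.
move=> ax.
have h : 0 < x - a by rewrite subr_gt0.
have ? := is_derive1_powR q h.
have hB : is_derive x 1 (fun s => s - a) 1 by apply: is_derive_eq; rewrite subr0.
rewrite -[X in is_derive _ _ _ X]mulr1.
exact: (@is_derive1_comp _ (fun y => y `^ q) (fun s => s - a)).
Qed.

Lemma is_derive_powRBr (b q x : R) : x < b ->
  is_derive x 1 (fun s => (b - s) `^ q) (- (q * (b - x) `^ (q - 1))).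
Proof.
move=> ax.
have h : 0 < b - x by rewrite subr_gt0.
have ? := is_derive1_powR q h.
have hB : is_derive x 1 (fun s => b - s) (-1).
  by have := is_deriveB (is_derive_cst b x 1) (is_derive_id x 1); rewrite sub0r.
rewrite -[X in is_derive _ _ _ X]mulrN1.
exact: (@is_derive1_comp _ (fun y => y `^ q) (fun s => b - s)).
Qed.

(** As [p + 1 > 0], the primitive stays continuous at the singular endpoint, which is all that the
    monotone exhaustion asks for. *)
Lemma integrable_powRBl (a b p : R) : -1 < p ->
  mu.-integrable `]a, b[ (EFin \o (fun s => (s - a) `^ p)).
Proof.
move=> p1; have q0 : 0 < p + 1 by lra.
apply: (@ge0_integrable_oo_derive _ (fun s => (p + 1)^-1 * (s - a) `^ (p + 1))
  (fun s => (s - a) `^ p)).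
- move=> x; apply: cvgM; first exact: cvg_cst.
  exact: within_continuous_powRBl.
- move=> x /andP[ax xb]; have ? := @is_derive_powRBl a (p + 1) x ax.
  apply: is_derive_eq; rewrite /GRing.scale/= addrK mulrA mulVf ?gt_eqF//.
  by rewrite mul1r ?mulr0 ?addr0.
- move=> x /andP[ax xb]; have [+ _] := @is_derive_powRBl a p x ax.
  by move=> /derivable1_diffP/differentiable_continuous.
- by move=> *; exact: powR_ge0.
Qed.

Lemma integrable_powRBr (a b p : R) : -1 < p ->
  mu.-integrable `]a, b[ (EFin \o (fun s => (b - s) `^ p)).
Proof.
move=> p1; have q0 : 0 < p + 1 by lra.
apply: (@ge0_integrable_oo_derive _ (fun s => - (p + 1)^-1 * (b - s) `^ (p + 1))
  (fun s => (b - s) `^ p)).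
- move=> x; apply: cvgM; first exact: cvg_cst.
  exact: within_continuous_powRBr.
- move=> x /andP[ax xb]; have ? := @is_derive_powRBr b (p + 1) x xb.
  apply: is_derive_eq; rewrite /GRing.scale/= addrK mulrNN mulrA mulVf ?gt_eqF//.
  by rewrite mul1r ?mulr0 ?addr0.
- move=> x /andP[ax xb]; have [+ _] := @is_derive_powRBr b p x xb.
  by move=> /derivable1_diffP/differentiable_continuous.
- by move=> *; exact: powR_ge0.
Qed.

Lemma bounded_integrable_itv (a b : R) (b0 b1 : bool) (f : R -> R) (M : R) :
  let I := [set` Interval (BSide b0 a) (BSide b1 b)] in
  measurable_fun I f -> (forall x, I x -> `|f x| <= M) ->
  mu.-integrable I (EFin \o f).
Proof.
move=> I mf fM; apply: measurable_bounded_integrable => //.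
- exact: measurable_itv.
- rewrite /I /= lebesgue_measure_itv/= lte_fin.
  by case: ifPn => // _; rewrite -EFinB ltry.
- exists M; split; first exact: num_real.
  by move=> y My x Ix /=; rewrite (le_trans (fM _ Ix))// ltW.
Qed.

(** Integrability is essential: a divergent integral of a nonnegative function would be read as
    0. *)
Lemma Rintegral_gt0 (D : set R) (f : R -> R) (a b c : R) :
  measurable D -> mu.-integrable D (EFin \o f) ->
  (forall x, D x -> 0 <= f x) -> a < b -> 0 < c -> `]a, b[ `<=` D ->
  (forall x, a < x < b -> c <= f x) -> 0 < \int[mu]_(x in D) f x.
Proof.
move=> mD intf f0 ab c0 abD cf.
have iab : mu.-integrable `]a, b[ (EFin \o f) by exact: integrableS intf.
apply: (@lt_le_trans _ _ (\int[mu]_(x in `]a, b[) f x)); last first.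
  apply: fine_le; [exact: integrable_fin_num|exact: integrable_fin_num|].
  apply: ge0_subset_integral => //; first by case/integrableP: intf.
apply: (@lt_le_trans _ _ (\int[mu]_(x in `]a, b[) c)).
  rewrite Rintegral_cst//= lebesgue_measure_itv/= lte_fin ab -EFinB/=.
  by rewrite mulr_gt0// subr_gt0.
apply: le_Rintegral => //.
  by apply: (@bounded_integrable_itv _ _ _ _ (fun=> c) c) => // *; rewrite ger0_norm// ltW.
Qed.

Lemma integrable_setU (A B : set R) (f : R -> \bar R) :
  measurable A -> measurable B -> [disjoint A & B] ->
  mu.-integrable A f -> mu.-integrable B f -> mu.-integrable (A `|` B) f.
Proof.
move=> mA mB AB /integrableP[mfA iA] /integrableP[mfB iB]; apply/integrableP.
have mf : measurable_fun (A `|` B) f by apply/measurable_funU.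
split => //; rewrite ge0_integral_setU//; first exact: lte_add_pinfty.
exact: measurableT_comp.
Qed.

(** Below 1 the exponential is at most 1 and the integrable power dominates; beyond 1 the power is
    at most 1 because [z < 1], and the exponential dominates. This range of [z] covers both [nu] and
    [1 - nu]. *)
Lemma integrable_gamma (z : R) : 0 < z < 1 ->
  mu.-integrable `]0, +oo[ (EFin \o (fun s => s `^ (z - 1) * expR (- s))).
Proof.
move=> /andP[z0 z1].
have mg A : measurable_fun A (fun s : R => s `^ (z - 1) * expR (- s)).
  apply: measurable_funM.
    by apply: (measurable_funS measurableT) => //; exact: measurable_powR.
  apply: (measurable_funS measurableT) => //.
  by apply: measurableT_comp => //; exact: oppr_measurable.
have e1 s : 0 <= s -> expR (- s) <= 1 :> R by move=> s0; rewrite -expR0 ler_expR; lra.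
have -> : `]0, +oo[%classic = `]0, 1[%classic `|` `[1, +oo[%classic :> set R.
  by rewrite -itv_bndbnd_setU// bnd_simp.
apply: integrable_setU => //.
- apply/disj_set2P; rewrite -subset0 => x [] /=; rewrite !in_itv/= andbT.
  by move=> /andP[_ x1]; rewrite leNgt x1.
-   have h : -1 < z - 1 by lra.
  have := @integrable_powRBl 0 1 _ h.
  apply: le_integrable => //; first by apply/measurable_EFinP; exact: mg.
  move=> x; rewrite /= in_itv/= => /andP[x0 x1]; rewrite lee_fin subr0.
  by rewrite normrM ler_piMr// ger0_norm ?expR_ge0// e1 ?ltW.
have : mu.-integrable `[1, +oo[ (EFin \o (fun s : R => expR (- s))).
  apply/integrableP; split.
    apply/measurable_EFinP; apply: (measurable_funS measurableT) => //.
    by apply: measurableT_comp => //; exact: oppr_measurable.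
  under eq_integral do rewrite /= ger0_norm ?expR_ge0//.
  rewrite (@ge0_continuous_FTC2y _ (fun s => expR (- s)) (fun s => - expR (- s)) 1 0).
  - by rewrite -EFinB ltry.
  - by move=> x _; exact: expR_ge0.
  - apply: continuous_subspaceT => x.
    by apply: continuous_comp; [exact: opp_continuous|exact: continuous_expR].
  - rewrite -oppr0; apply: cvgN; exact: cvgr_expR.
  - by move=> x _.
  - apply: cvg_at_right_filter; apply: cvgN.
    by apply: continuous_comp; [exact: opp_continuous|exact: continuous_expR].
  - move=> x _; rewrite derive1E.
    have h1 : is_derive x 1 (fun s : R => - s) (- 1).
      by have := is_deriveN (is_derive_id x 1).
    have [_ h3] := is_deriveN (is_derive1_comp (is_derive_expR (- x)) h1).
    by apply: (etrans h3); ring.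
apply: le_integrable => //; first by apply/measurable_EFinP; exact: mg.
move=> x; rewrite /= in_itv/= andbT => x1; rewrite lee_fin.
rewrite normrM ler_piMl// ger0_norm ?powR_ge0//.
rewrite (_ : z - 1 = - (1 - z)); last by ring.
have x0 : 0 < x by exact: lt_le_trans ltr01 x1.
rewrite powRN invf_le1 ?powR_gt0//.
by rewrite -[leLHS](powRr0 x) ler_powR//; lra.
Qed.

Lemma Gamma_gt0 (z : R) : 0 < z < 1 -> 0 < Gamma z.
Proof.
move=> z01; have /andP[z0 z1] := z01.
(* On the unit interval the power is at least 1, its exponent being negative, and the exponential is
   at least [expR (- 1)]. *)
apply: (@Rintegral_gt0 _ _ 0 1 (expR (- 1))) => //.
- exact: integrable_gamma.
- by move=> x _; rewrite mulr_ge0 ?powR_ge0 ?expR_ge0.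
- by apply: subset_itvl.
- move=> x /andP[x0 x1]; apply: (@le_trans _ _ (1 * expR (- x))).
    by rewrite mul1r ler_expR; lra.
  rewrite ler_wpM2r ?expR_ge0// (_ : z - 1 = - (1 - z)); last by ring.
  rewrite powRN -[leLHS]invr1 lef_pV2 ?posrE ?powR_gt0// -[leRHS](powRr0 x).
  by rewrite ger_powR//; [rewrite x0/= ltW|lra].
Qed.

End powers.

(** * Joint measurability and Fubini for real-valued integrals *)

Section fubini.
Context {R : realType}.
Notation mu := (@lebesgue_measure R).

(* [f] is the pointwise limit of the functions [f (floor (n x) / n) y], which are
   constant in [x] on countably many strips. *)
Lemma measurable_fun_caratheodory (f : R -> R -> R) :
  (forall y, continuous (f^~ y)) -> (forall x, measurable_fun [set: R] (f x)) ->
  measurable_fun [set: R * R] (fun z : R * R => f z.1 z.2).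
Proof.
move=> cf mf.
pose r n (x : R) : R := (Num.floor (n.+1%:R * x))%:~R / n.+1%:R.
apply: (@measurable_fun_cvg _ _ _ _ (fun n z => f (r n z.1) z.2)) => [n|z _].
  move=> _ Y mY; rewrite setTI.
  pose E (k : int) : set (R * R) :=
    [set x : R | Num.floor (n.+1%:R * x) = k] `*` (f (k%:~R / n.+1%:R) @^-1` Y).
  rewrite (_ : _ @^-1` _ = \bigcup_k E k); last first.
    apply/seteqP; split=> [[x y]/= fY|[x y] [k _ [/= <-//]]].
    by exists (Num.floor (n.+1%:R * x)).
  apply: countable_bigcupT_measurable => [|k]; first exact: countableP.
  apply: measurableX; last by rewrite -[X in measurable X]setTI; exact: mf.
  rewrite (_ : mkset _ = `[k%:~R / n.+1%:R, (k + 1)%:~R / n.+1%:R[%classic).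
    exact: measurable_itv.
  apply/seteqP; split=> x /=; rewrite in_itv/= ler_pdivrMr// ltr_pdivlMr// (mulrC x).
    by move=> <-; exact: floor_itv.
  exact: floor_def.
have rx : r n z.1 @[n --> \oo] --> z.1.
  apply/cvgrPdist_lt => e e0; near=> n.
  have n0 : 0 < n.+1%:R :> R by [].
  have /andP[h1 h2] := floor_itv (n.+1%:R * z.1).
  have h3 : r n z.1 <= z.1 by rewrite /r ler_pdivrMr// [leRHS]mulrC.
  rewrite ger0_norm ?subr_ge0//.
  apply: (@le_lt_trans _ _ n.+1%:R^-1).
    rewrite lerBlDr -[X in X + _]mul1r -mulrDl ler_pdivlMr// addrC mulrC.
    by move: h2; rewrite intrD => /ltW.
  by near: n; exact: (near_infty_natSinv_lt (PosNum e0)).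
exact: (@cvg_comp _ _ _ (fun n => r n z.1) (f^~ z.2) _ _ _ rx (cf z.2 z.1)).
Unshelve. all: by end_near. Qed.

(** All sections, not just almost all, are required to be integrable, so that each inner real-valued
    integral agrees with the extended one. *)
Lemma Rintegral_fubini (f : R * R -> R) :
  measurable_fun [set: R * R] f ->
  (forall x, mu.-integrable [set: R] (fun y => (f (x, y))%:E)) ->
  (forall y, mu.-integrable [set: R] (fun x => (f (x, y))%:E)) ->
  (\int[mu]_y \int[mu]_x `|f (x, y)|%:E < +oo)%E ->
  [/\ mu.-integrable [set: R] (fun x => (\int[mu]_y f (x, y))%:E),
      mu.-integrable [set: R] (fun y => (\int[mu]_x f (x, y))%:E) &
      \int[mu]_x \int[mu]_y f (x, y) = \int[mu]_y \int[mu]_x f (x, y)].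
Proof.
move=> mf f1 f2 foo.
have mEf : measurable_fun [set: R * R] (EFin \o f) by exact/measurable_EFinP.
have imf : (mu \x mu)%E.-integrable [set: R * R] (EFin \o f).
  by apply/integrable21ltyP.
have E1 x : (\int[mu]_y f (x, y))%:E = (\int[mu]_y (f (x, y))%:E)%E.
  by rewrite fineK//; apply: integrable_fin_num.
have E2 y : (\int[mu]_x f (x, y))%:E = (\int[mu]_x (f (x, y))%:E)%E.
  by rewrite fineK//; apply: integrable_fin_num.
split.
- apply: eq_integrable (integrable_fubini_F imf) => // x _; exact/esym/E1.
(* The second marginal is the first marginal of the function with swapped variables. *)
- have mg : measurable_fun [set: R * R] (fun z : R * R => (f (z.2, z.1))%:E).
    apply/measurable_EFinP; apply: (measurableT_comp (f := f)) => //.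
    by apply: measurable_fun_pair; [exact: measurable_snd|exact: measurable_fst].
  have img : (mu \x mu)%E.-integrable [set: R * R] (fun z : R * R => (f (z.2, z.1))%:E).
    by apply/integrable12ltyP.
  apply: eq_integrable (integrable_fubini_F img) => // x _; exact/esym/E2.
- transitivity (fine (\int[mu]_x \int[mu]_y (f (x, y))%:E)%E).
    by congr fine; apply: eq_integral => x _; exact: E1.
  transitivity (fine (\int[mu]_y \int[mu]_x (f (x, y))%:E)%E).
    by congr fine; exact: (Fubini imf).
  by congr fine; apply: eq_integral => y _; rewrite E2.
Qed.

End fubini.

(** * The Abel kernels and the Beta integral *)

Section beta.
Context {R : realType}.
Notation mu := (@lebesgue_measure R).

Lemma EFin_integrableZl d (T : measurableType d) (m : {measure set T -> \bar R})
    (D : set T) (c : R) (f : T -> R) : measurable D ->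
  m.-integrable D (EFin \o f) -> m.-integrable D (EFin \o (fun x => c * f x)).
Proof. by move=> mD fi; have := integrableZl mD c fi. Qed.

Lemma EFin_integrableD d (T : measurableType d) (m : {measure set T -> \bar R})
    (D : set T) (f g : T -> R) : measurable D ->
  m.-integrable D (EFin \o f) -> m.-integrable D (EFin \o g) ->
  m.-integrable D (EFin \o (fun x => f x + g x)).
Proof. by move=> mD fi gi; have := integrableD mD fi gi. Qed.

Lemma EFin_integrableB d (T : measurableType d) (m : {measure set T -> \bar R})
    (D : set T) (f g : T -> R) : measurable D ->
  m.-integrable D (EFin \o f) -> m.-integrable D (EFin \o g) ->
  m.-integrable D (EFin \o (fun x => f x - g x)).
Proof. by move=> mD fi gi; have := integrableB mD fi gi. Qed.

Lemma powR_le_neg (x y r : R) : 0 < y -> y <= x -> r <= 0 -> x `^ r <= y `^ r.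
Proof.
move=> y0 yx r0; have x0 := lt_le_trans y0 yx.
rewrite -(opprK r) 2!(powRN _ (- r)) lef_pV2 ?posrE ?powR_gt0//.
by rewrite ge0_ler_powR ?nnegrE ?(ltW x0) ?(ltW y0)//; lra.
Qed.

Lemma powR_ge1_neg (x r : R) : 0 < x -> x <= 1 -> r <= 0 -> 1 <= x `^ r.
Proof. by move=> x0 x1 r0; have := powR_le_neg _ _ _ x0 x1 r0; rewrite powR1. Qed.

Lemma measurable_fun_powR d (T : measurableType d) (D : set T) (g : T -> R) (p : R) :
  measurable_fun D g -> measurable_fun D (fun x => g x `^ p).
Proof. by move=> mg; exact: (measurableT_comp (@measurable_powR R p) mg). Qed.

(* Outside [tau < s < t] this is a junk value: [powR] is [1] on negative reals. *)
Definition abel_kernel (nu t tau s : R) : R := (t - s) `^ (nu - 1) * (s - tau) `^ (- nu).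

(** Euler's Beta value B(nu, 1 - nu), that is, Gamma(nu) Gamma(1 - nu). *)
Definition beta_abel (nu : R) : R := \int[mu]_(s in `]0, 1[) abel_kernel nu 1 0 s.

Lemma abel_kernel_ge0 (nu t tau s : R) : 0 <= abel_kernel nu t tau s.
Proof. by rewrite mulr_ge0 ?powR_ge0. Qed.

Lemma measurable_abel_kernel (nu t tau : R) (D : set R) :
  measurable_fun D (abel_kernel nu t tau).
Proof.
apply: (measurable_funS measurableT) => //; rewrite /abel_kernel.
by apply: measurable_funM; apply: measurable_fun_powR; exact: measurable_funB.
Qed.

Variable nu : R.
Hypothesis nu01 : 0 < nu < 1.

(** Each factor is singular at one end only. On the half away from its singularity it is bounded by
    its value at the midpoint, so the sum of two one-sided powers dominates the product. *)
Lemma integrable_abel_kernel01 : mu.-integrable `]0, 1[ (EFin \o abel_kernel nu 1 0).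
Proof.
have /andP[nu0 nu1] := nu01.
have h1 : -1 < nu - 1 by lra.
have h2 : -1 < - nu by lra.
have i1 : mu.-integrable `]0, 1[ (EFin \o (fun s => 2^-1 `^ (- nu) * (1 - s) `^ (nu - 1))).
  by apply: EFin_integrableZl => //; exact: integrable_powRBr.
have i2 : mu.-integrable `]0, 1[ (EFin \o (fun s => 2^-1 `^ (nu - 1) * (s - 0) `^ (- nu))).
  by apply: EFin_integrableZl => //; exact: integrable_powRBl.
have : mu.-integrable `]0, 1[ (EFin \o (fun s => 2^-1 `^ (- nu) * (1 - s) `^ (nu - 1)
    + 2^-1 `^ (nu - 1) * (s - 0) `^ (- nu))).
  exact: EFin_integrableD.
apply: le_integrable => //.
  by apply/measurable_EFinP; exact: measurable_abel_kernel.
move=> s; rewrite /= in_itv/= => /andP[s0 s1]; rewrite lee_fin subr0.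
rewrite ger0_norm ?abel_kernel_ge0// ger0_norm; last first.
  by rewrite addr_ge0// mulr_ge0 ?powR_ge0.
rewrite /abel_kernel subr0; have [s2|s2] := leP s 2^-1.
  rewrite -[leLHS]add0r lerD// ?mulr_ge0 ?powR_ge0// ler_wpM2r ?powR_ge0//.
  by apply: powR_le_neg; lra.
rewrite -[leLHS]addr0 lerD// ?mulr_ge0 ?powR_ge0// mulrC ler_wpM2r ?powR_ge0//.
by apply: powR_le_neg; lra.
Qed.

Lemma beta_abel_gt0 : 0 < beta_abel nu.
Proof.
have /andP[nu0 nu1] := nu01.
apply: (@Rintegral_gt0 _ _ _ 0 1 1) => //.
- exact: integrable_abel_kernel01.
- by move=> x _; exact: abel_kernel_ge0.
- move=> x /andP[x0 x1]; rewrite /abel_kernel -[leLHS]mulr1 ler_pM//;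
    by apply: powR_ge1_neg; lra.
Qed.

(* The substitution [s = tau + (t - tau) x] cancels the powers of [t - tau]. *)
Lemma integral_abel_kernel (t tau : R) : tau < t ->
  (\int[mu]_(s in `]tau, t[) (abel_kernel nu t tau s)%:E = (beta_abel nu)%:E)%E.
Proof.
move=> taut; have c0 : 0 < t - tau by rewrite subr_gt0.
rewrite integral_mkcond.
transitivity (\int[mu]_s (((abel_kernel nu t tau) \_ `]tau, t[) s)%:E)%E.
  by rewrite restrict_EFin.
rewrite (@ge0_integral_affine _ tau (t - tau)) //; last 2 first.
  by apply/(measurable_restrictT _ _).1 => //; exact: measurable_abel_kernel.
  by move=> x; rewrite patchE; case: ifPn => // _; exact: abel_kernel_ge0.
rewrite -ge0_integralZl//; last 3 first.
  apply/measurable_EFinP.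
  apply: (@measurableT_comp _ _ _ _ _ _ _ _ (fun x => tau + (t - tau) * x)).
    by apply/(measurable_restrictT _ _).1 => //; exact: measurable_abel_kernel.
  by apply: measurable_funD => //; exact: mulrl_measurable.
  by move=> x _; rewrite lee_fin patchE; case: ifPn => // _; exact: abel_kernel_ge0.
  by rewrite lee_fin ltW.
rewrite /beta_abel /Rintegral fineK; last first.
  by apply: integrable_fin_num => //; exact: integrable_abel_kernel01.
rewrite [RHS]integral_mkcond.
apply: eq_integral => x _; rewrite [LHS]/= [RHS]patchE [in LHS]patchE.
have -> : (tau + (t - tau) * x \in `]tau, t[%classic) = (x \in `]0, 1[%classic).
  apply/idP/idP; rewrite !inE/= !in_itv/= => /andP[x0 x1]; apply/andP; split; nra.
case: ifPn => [|_]; last by rewrite mule0.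
rewrite inE/= in_itv/= => /andP[x0 x1]; congr EFin; rewrite /abel_kernel.
rewrite (_ : t - (tau + _) = (t - tau) * (1 - x)); last by ring.
rewrite (_ : tau + _ - tau = (t - tau) * x) ?subr0; last by ring.
rewrite !powRM ?subr_ge0 ?(ltW taut) ?(ltW x0) ?(ltW x1)//.
transitivity ((t - tau) * ((t - tau) `^ (nu - 1) * (t - tau) `^ (- nu))
  * ((1 - x) `^ (nu - 1) * x `^ (- nu))); first by ring.
rewrite -powRD; last by apply/implyP => _; rewrite gt_eqF.
rewrite (_ : nu - 1 - nu = - 1); last by ring.
by rewrite powR_inv1 ?(ltW c0)// divff ?gt_eqF// mul1r.
Qed.

End beta.

(** * Alikhanov's pointwise inequality *)

Section alikhanov.
Context {R : realType}.
Notation mu := (@lebesgue_measure R).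

Lemma is_derive_continuous (f : R -> R) (x df : R) :
  is_derive x 1 f df -> {for x, continuous f}.
Proof. by move=> [+ _] => /derivable1_diffP/differentiable_continuous. Qed.

(* With [F r := - (v s - v r)^2 / 2 * (s - r)^(- nu)], the difference of the two
   integrands exceeds [F'] by a nonnegative term, and [F 0 <= 0 = F s]: the
   quadratic zero of [(v s - v r)^2] at [s] beats the singularity. *)
Lemma alikhanov_inequality (nu s : R) (v p : R -> R) : 0 < nu < 1 -> 0 < s ->
  {within `[0, s], continuous v} ->
  (forall r, 0 < r <= s -> is_derive r 1 v (p r)) ->
  (forall r, 0 < r < s -> {for r, continuous p}) ->
  mu.-integrable `]0, s[ (EFin \o (fun r => p r * (s - r) `^ (- nu))) ->
  mu.-integrable `]0, s[ (EFin \o (fun r => v r * (p r * (s - r) `^ (- nu)))) ->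
  \int[mu]_(r in `]0, s[) (v r * (p r * (s - r) `^ (- nu)))
  <= v s * \int[mu]_(r in `]0, s[) (p r * (s - r) `^ (- nu)).
Proof.
move=> /andP[nu0 nu1] s0 cv dv cp ip ivp.
rewrite -RintegralZl//= -subr_ge0 -RintegralB//=; last exact: EFin_integrableZl.
pose g r := v s * (p r * (s - r) `^ (- nu)) - v r * (p r * (s - r) `^ (- nu)).
pose F r := - 2^-1 * ((v s - v r) ^+ 2 * (s - r) `^ (- nu)).
pose dF r := g r - 2^-1 * ((v s - v r) ^+ 2 * (nu * (s - r) `^ (- nu - 1))).
have Fs : F s = 0 by rewrite /F subrr expr0n/= mul0r mulr0.
have F0 : F 0 <= 0.
  by rewrite /F mulNr oppr_le0 mulr_ge0 ?invr_ge0// mulr_ge0 ?sqr_ge0 ?powR_ge0.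
have dK r : r < s -> is_derive r 1 (fun r => (s - r) `^ (- nu))
    (nu * (s - r) `^ (- nu - 1)).
  move=> rs; apply: (is_derive_eq (is_derive_powRBr s (- nu) r rs)).
  by rewrite mulNr opprK.
have dFE r : 0 < r < s -> is_derive r 1 F (dF r).
  move=> /andP[r0 rs].
  have d1 : is_derive r 1 v (p r) by apply: dv; rewrite r0 ltW.
  have d2 : is_derive r 1 (fun r => v s - v r) (- p r).
    apply: (is_derive_eq (is_deriveB (is_derive_cst (v s) r 1) d1)).
    by rewrite sub0r.
  have d3 := is_deriveM (is_deriveM d2 d2) (dK r rs).
  have d4 := is_deriveZ (- 2^-1) d3.
  apply: (is_derive_eq d4).
  by rewrite /dF /g /GRing.scale/=; rewrite {1}[(_ * _) r]/GRing.mul/=; field.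
have cF : {within `[0, s], continuous F}.
  have [_ v0 _] := (continuous_within_itvP v s0).1 cv.
  apply/(continuous_within_itvP F s0); split.
  - by move=> r; rewrite in_itv/= => /dFE; exact: is_derive_continuous.
  - apply: cvgM; first exact: cvg_cst.
    apply: cvgM.
      by apply: cvgM; apply: cvgB => //; exact: cvg_cst.
    by apply: cvg_at_right_filter; exact: (is_derive_continuous _ _ _ (dK 0 s0)).
  (* Differentiability at [s] itself is used here: with the Caratheodory slope [G],
     [v s - v r = G r * (s - r)], so [F r] is a bounded factor times a power of [s - r] with
     exponent [2 - nu > 0], and tends to 0. *)
  - have ds : is_derive s 1 v (p s) by apply: dv; rewrite s0 lexx.
    have [G [vG cG _]] := (is_derive1_caratheodory v s (p s)).1 ds.
    have q0 : 0 < 2 - nu by lra.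
    have [_ _ K0] := (continuous_within_itvP _ s0).1
      (@within_continuous_powRBr _ 0 s (2 - nu) q0).
    rewrite Fs; apply: (@cvg_trans _
      (- 2^-1 * ((G r * G r) * (s - r) `^ (2 - nu)) @[r --> s^'-])).
      apply: near_eq_cvg; near=> r.
      have rs : r < s by [].
      have sr0 : 0 < s - r by lra.
      rewrite powRD; last by rewrite (gt_eqF sr0) implybT.
      rewrite (powR_mulrn 2) ?(ltW sr0)// /F.
      have -> : v s - v r = G r * (s - r) by rewrite -opprB vG; ring.
      ring.
    rewrite -(mulr0 (- 2^-1)) -(mulr0 (G s * G s)).
    apply: cvgM; first exact: cvg_cst.
    apply: cvgM; last by move: K0; rewrite subrr powR0 ?gt_eqF.
    by apply: cvgM; exact: cvg_at_left_filter.
have ig : mu.-integrable `]0, s[ (EFin \o g).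
  have ip' := @EFin_integrableZl _ _ _ mu _ (v s) _ (measurable_itv _) ip.
  exact: EFin_integrableB.
apply: (@le_trans _ _ (F s - F 0)); first by rewrite Fs sub0r oppr_ge0.
(* Only [dF <= g] enters, so the discarded square term need not be shown integrable. *)
apply: (@le_Rintegral_oo_derive _ F dF g) => //; first exact: ltW.
- move=> r /andP[r0 rs]; rewrite /dF gerBl mulr_ge0 ?invr_ge0// mulr_ge0 ?sqr_ge0//.
  by rewrite mulr_ge0 ?powR_ge0 ?ltW.
- move=> r /andP[r0 rs].
  have cp' : {for r, continuous p} by apply: cp; rewrite r0.
  have cv' : {for r, continuous v}.
    by apply: (@is_derive_continuous _ _ (p r)); apply: dv; rewrite r0 ltW.
  have cK := is_derive_continuous _ _ _ (dK r rs).
  apply: cvgB; apply: cvgM; first [exact: cvg_cst|by []|by apply: cvgM].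
Unshelve. all: by end_near. Qed.

End alikhanov.

(** * The energy estimate in space at a fixed time *)

Section spatial.
Context {R : realType}.
Notation mu := (@lebesgue_measure R).

Lemma continuous_integrable01 (f : R -> R) : continuous f ->
  mu.-integrable `[0, 1] (EFin \o f).
Proof.
move=> cf; apply: continuous_compact_integrable; first exact: segment_compact.
exact: continuous_subspaceT.
Qed.

(** The weight [c / 4] is chosen because the inequality is used twice, for the source and for the
    boundary datum; together they consume half of the coercivity constant [c]. *)
Lemma young_scaled (c L N a b : R) : 0 < c -> `|a| <= L * N ->
  a * b <= c / 4 * N ^+ 2 + L ^+ 2 / c * b ^+ 2.
Proof.
move=> c0 aLN; apply: (@le_trans _ _ (L * N * `|b|)).
  by rewrite (le_trans (ler_norm _))// normrM ler_wpM2r.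
rewrite -subr_ge0 -(real_normK (num_real b)).
rewrite (_ : _ - _ = (c / 2 * N - L * `|b|) ^+ 2 / c); last by field; rewrite gt_eqF.
by rewrite divr_ge0 ?sqr_ge0// ltW.
Qed.

(** The derivatives of both [v] and [- v] lie below [|q|], so the one-sided fundamental theorem
    bounds the increment from either side. *)
Lemma norm_increment_le (v q : R -> R) (x y : R) :
  continuous v -> continuous q ->
  (forall x : R, 0 < x < 1 -> is_derive x 1 v (q x)) ->
  0 <= x -> x <= y -> y <= 1 -> `|v y - v x| <= \int[mu]_(z in `[0, 1]) `|q z|.
Proof.
move=> cv cq dv x0 xy y1.
have cnq : continuous (fun z => `|q z|).
  by move=> z; apply: cvg_norm; exact: cq.
have inq := continuous_integrable01 _ cnq.
have xy01 : `]x, y[%classic `<=` (`[0, 1]%classic : set R).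
  by move=> z; rewrite /= !in_itv/= => /andP[? ?]; apply/andP; split; lra.
have ixy : mu.-integrable `]x, y[ (EFin \o (fun z => `|q z|)).
  exact: integrableS inq.
have dvxy z : x < z < y -> is_derive z 1 v (q z).
  by move=> /andP[? ?]; apply: dv; apply/andP; split; lra.
apply: (@le_trans _ _ (\int[mu]_(z in `]x, y[) `|q z|)); last first.
  apply: fine_le; [exact: integrable_fin_num|exact: integrable_fin_num|].
  by apply: ge0_subset_integral => //; case/integrableP: inq.
rewrite ler_norml; apply/andP; split.
  rewrite lerNl (_ : - (v y - v x) = (- v) y - (- v) x); last by rewrite !fctE; ring.
  apply: (@le_Rintegral_oo_derive _ (- v) (- q) (fun z => `|q z|)) => //.
  - by apply: continuous_subspaceT => z; apply: cvgN; exact: cv.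
  - by move=> z xzy; apply: is_deriveN; exact: dvxy.
  - by move=> z _; rewrite /= -normrN ler_norm.
  - by move=> z _; exact: cnq.
apply: (@le_Rintegral_oo_derive _ v q (fun z => `|q z|)) => //.
- exact: continuous_subspaceT.
- by move=> z _; exact: ler_norm.
- by move=> z _; exact: cnq.
Qed.

(** The variance of [q] on an interval of length 1 is nonnegative. *)
Lemma sqr_Rintegral01_le (q : R -> R) : continuous q ->
  (\int[mu]_(x in `[0, 1]) q x) ^+ 2 <= \int[mu]_(x in `[0, 1]) q x ^+ 2.
Proof.
move=> cq; set N := \int[mu]_(x in _) q x.
have cq2 : continuous (fun x => q x ^+ 2) by move=> x; apply: cvgM; exact: cq.
have iq := continuous_integrable01 _ cq.
have iq2 := continuous_integrable01 _ cq2.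
have iNq : mu.-integrable `[0, 1] (EFin \o (fun x => 2 * N * q x)).
  exact: EFin_integrableZl.
have iN : mu.-integrable `[0, 1] (EFin \o (fun=> N ^+ 2)).
  by apply: continuous_integrable01 => x; exact: cvg_cst.
have : 0 <= \int[mu]_(x in `[0, 1]) (q x - N) ^+ 2.
  by apply: Rintegral_ge0 => x _; exact: sqr_ge0.
rewrite (_ : \int[mu]_(x in _) _ =
    \int[mu]_(x in `[0, 1]) ((q x ^+ 2 - 2 * N * q x) + N ^+ 2)); last first.
  by apply: eq_Rintegral => x _; ring.
rewrite (@RintegralD _ _ _ mu _ (fun x => q x ^+ 2 - 2 * N * q x) (fun=> N ^+ 2))//.
- rewrite RintegralB//.
  rewrite RintegralZl// Rintegral_cst// -/N.
  rewrite /= lebesgue_measure_itv/= lte_fin ltr01 oppr0 adde0/=.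
  by lra.
- exact: EFin_integrableB.
Qed.

(* [q], [D] and [F] stand for [u_x], the Caputo derivative and the source term
   at a fixed time. *)
Lemma spatial_energy_bound (al ga c m : R) (v q k D F : R -> R) :
  al <> 1 -> ga <= 0 -> 0 < c ->
  continuous v -> continuous q -> continuous k -> continuous D -> continuous F ->
  (forall x : R, 0 < x < 1 -> is_derive x 1 v (q x)) ->
  (forall x : R, 0 < x < 1 -> is_derive x 1 (fun x => k x * q x) (D x - F x)) ->
  (forall x : R, 0 <= x <= 1 -> c <= k x) ->
  v 0 = al * v 1 -> k 1 * q 1 = al * (k 0 * q 0) + ga * v 1 + m ->
  \int[mu]_(x in `[0, 1]) (v x * D x) <=
  - (c / 2) * (\int[mu]_(x in `[0, 1]) q x ^+ 2)
  + (1 + `|1 - al|^-1) ^+ 2 / c * (\int[mu]_(x in `[0, 1]) F x ^+ 2 + m ^+ 2).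
Proof.
move=> al1 ga0 c0 cv cq ck cD cF dv dkq kc bv bq.
set L := 1 + _; set S := \int[mu]_(x in _) q x ^+ 2.
pose N := \int[mu]_(x in `[0, 1]) `|q x|.
have cnq : continuous (fun z => `|q z|) by move=> z; apply: cvg_norm; exact: cq.
have N0 : 0 <= N by apply: Rintegral_ge0.
have NS : N ^+ 2 <= S.
  rewrite (le_trans (sqr_Rintegral01_le _ cnq))// le_eqVlt; apply/orP; left.
  by apply/eqP; apply: eq_Rintegral => x _; rewrite real_normK// num_real.
have al0 : 0 < `|1 - al| by rewrite normr_gt0 subr_eq0 eq_sym; apply/eqP.
have v1N : `|v 1| <= `|1 - al|^-1 * N.
  rewrite mulrC ler_pdivlMr//.
  have := norm_increment_le v q 0 1 cv cq dv (lexx 0) ler01 (lexx 1).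
  by rewrite bv (_ : v 1 - _ = v 1 * (1 - al)) ?normrM//; ring.
(* Origin of [L]: the summand [|1 - al|^-1] bounds [v 1], and the summand 1 bounds the increment
   from [x] to 1. *)
have vN x : 0 <= x <= 1 -> `|v x| <= L * N.
  move=> /andP[x0 x1]; have := norm_increment_le v q x 1 cv cq dv x0 x1 (lexx 1).
  rewrite -/N => h; rewrite /L mulrDl mul1r.
  rewrite (_ : v x = v 1 - (v 1 - v x)); last by ring.
  by rewrite (le_trans (ler_normB _ _))// addrC lerD.
have cvF : continuous (fun x => v x * F x) by move=> x; apply: cvgM; [exact: cv|exact: cF].
have cDF : continuous (fun x => D x - F x) by move=> x; apply: cvgB; [exact: cD|exact: cF].
have cvDF : continuous (fun x => v x * (D x - F x)).
  by move=> x; apply: cvgM; [exact: cv|exact: cDF].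
have ckq : continuous (fun x => k x * q x) by move=> x; apply: cvgM; [exact: ck|exact: cq].
have cqkq : continuous (fun x => q x * (k x * q x)).
  by move=> x; apply: cvgM; [exact: cq|exact: ckq].
have cq2 : continuous (fun x => q x ^+ 2) by move=> x; apply: cvgM; exact: cq.
have cF2 : continuous (fun x => F x ^+ 2) by move=> x; apply: cvgM; exact: cF.
have LR (f df : R -> R) : continuous f ->
    (forall x : R, 0 < x < 1 -> is_derive x 1 f (df x)) ->
    derivable_oo_LRcontinuous f 0 1.
  move=> cf dff; split.
  - by move=> x; rewrite in_itv/= => /dff[].
  - by apply: cvg_at_right_filter; exact: cf.
  - by apply: cvg_at_left_filter; exact: cf.
have ibp := @Rintegration_by_parts R v (fun x => k x * q x) q (fun x => D x - F x)
  0 1 ltr01.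
have {}ibp : \int[mu]_(x in `[0, 1]) (v x * (D x - F x)) =
    v 1 * (k 1 * q 1) - v 0 * (k 0 * q 0) - \int[mu]_(x in `[0, 1]) (q x * (k x * q x)).
  apply: ibp.
  - exact: continuous_subspaceT.
  - exact: LR dv.
  - by move=> x; rewrite in_itv/= derive1E => /dv[].
  - exact: continuous_subspaceT.
  - exact: LR dkq.
  - by move=> x; rewrite in_itv/= derive1E => /dkq[].
have kS : c * S <= \int[mu]_(x in `[0, 1]) (q x * (k x * q x)).
  rewrite -RintegralZl//; last exact: continuous_integrable01.
  apply: le_Rintegral => //.
  - apply: EFin_integrableZl => //; exact: continuous_integrable01.
  - exact: continuous_integrable01.
  - move=> x; rewrite /= in_itv/= => x01.
    rewrite (_ : q x * (k x * q x) = k x * q x ^+ 2); last by ring.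
    by rewrite ler_wpM2r ?sqr_ge0// kc.
have FE : \int[mu]_(x in `[0, 1]) (v x * F x) <=
    L ^+ 2 / c * \int[mu]_(x in `[0, 1]) F x ^+ 2 + c / 4 * N ^+ 2.
  rewrite -RintegralZl//; last exact: continuous_integrable01.
  rewrite -[X in _ + X](_ : \int[mu]_(x in `[0, 1]) (c / 4 * N ^+ 2) = _); last first.
    rewrite Rintegral_cst//= lebesgue_measure_itv/= lte_fin ltr01 oppr0 adde0/=.
    by rewrite mulr1.
  have i1 : mu.-integrable `[0, 1] (EFin \o (fun x => L ^+ 2 / c * F x ^+ 2)).
    by apply: EFin_integrableZl => //; exact: continuous_integrable01.
  have i2 : mu.-integrable `[0, 1] (EFin \o (fun=> c / 4 * N ^+ 2)).
    by apply: continuous_integrable01 => x; exact: cvg_cst.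
  rewrite -RintegralD//.
  apply: le_Rintegral => //.
  - exact: continuous_integrable01.
  - exact: EFin_integrableD.
  - move=> x; rewrite /= in_itv/= => x01; rewrite addrC.
    by apply: young_scaled => //; exact: vN.
have mE : v 1 * m <= c / 4 * N ^+ 2 + L ^+ 2 / c * m ^+ 2.
  by apply: young_scaled => //; apply: vN; rewrite ler01 lexx.
have -> : \int[mu]_(x in `[0, 1]) (v x * D x) =
    \int[mu]_(x in `[0, 1]) (v x * (D x - F x)) + \int[mu]_(x in `[0, 1]) (v x * F x).
  rewrite -RintegralD//; [|exact: continuous_integrable01..].
  by apply: eq_Rintegral => x _; ring.
rewrite ibp (_ : v 1 * (k 1 * q 1) - v 0 * (k 0 * q 0) = ga * v 1 ^+ 2 + v 1 * m);
  last by rewrite bv bq; ring.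
have gv : ga * v 1 ^+ 2 <= 0 by rewrite mulr_le0_ge0// sqr_ge0.
have cNS : c * N ^+ 2 <= c * S by rewrite ler_wpM2l// ltW.
move: FE mE kS gv cNS.
set I1 := \int[mu]_(x in _) (v x * F x); set I2 := \int[mu]_(x in _) (q x * _).
set I3 := \int[mu]_(x in _) F x ^+ 2; set A := L ^+ 2 / c.
(* Naming the products leaves a linear inequality: coercivity supplies [- cS], the two Young bounds
   cost [cN / 4] each, and [cN <= cS] leaves [- cS / 2]. *)
set cN := c * N ^+ 2; set cS := c * S.
have -> : c / 4 * N ^+ 2 = cN / 4 by rewrite /cN; ring.
have -> : - (c / 2) * S = - (cS / 2) by rewrite /cS; ring.
rewrite mulrDr; lra.
Qed.

End spatial.

(** * Fubini on product sets and under a one-variable majorant *)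

Section fubini_on.
Context {R : realType}.
Notation mu := (@lebesgue_measure R).

Lemma Rintegral_fubini_on (A B : set R) (f : R -> R -> R) :
  measurable A -> measurable B ->
  measurable_fun [set: R * R] (fun z : R * R => f z.1 z.2) ->
  (forall x, A x -> mu.-integrable B (EFin \o f x)) ->
  (forall y, B y -> mu.-integrable A (EFin \o f^~ y)) ->
  (\int[mu]_(y in B) \int[mu]_(x in A) `|f x y|%:E < +oo)%E ->
  [/\ mu.-integrable A (EFin \o (fun x => \int[mu]_(y in B) f x y)),
      mu.-integrable B (EFin \o (fun y => \int[mu]_(x in A) f x y)) &
      \int[mu]_(x in A) \int[mu]_(y in B) f x y =
      \int[mu]_(y in B) \int[mu]_(x in A) f x y].
Proof.
move=> mA mB mf f1 f2 foo.
pose g (z : R * R) : R := ((fun z => f z.1 z.2) \_ (A `*` B)) z.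
have gA x : x \in A -> (fun y => g (x, y)) = (f x) \_ B.
  rewrite inE => Ax; apply/funext => y; rewrite /g !patchE.
  rewrite (_ : ((x, y) \in A `*` B) = (y \in B))//.
  by apply/idP/idP; rewrite !inE => // -[].
have gAN x : x \notin A -> (fun y => g (x, y)) = cst 0.
  move=> xA; apply/funext => y; rewrite /g patchE ifF//.
  by apply: contraNF xA; rewrite !inE => -[].
have gB y : y \in B -> (fun x => g (x, y)) = (f^~ y) \_ A.
  rewrite inE => By; apply/funext => x; rewrite /g !patchE.
  rewrite (_ : ((x, y) \in A `*` B) = (x \in A))//.
  by apply/idP/idP; rewrite !inE => // -[].
have gBN y : y \notin B -> (fun x => g (x, y)) = cst 0.
  move=> yB; apply/funext => x; rewrite /g patchE ifF//.
  by apply: contraNF yB; rewrite !inE => -[].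
have EA : (fun x => \int[mu]_(y in B) f x y) \_ A = fun x => \int[mu]_y g (x, y).
  apply/funext => x; rewrite patchE; case: ifPn => xA.
    by rewrite Rintegral_mkcond (gA x xA).
  by rewrite (gAN x xA) Rintegral_cst// mul0r.
have EB : (fun y => \int[mu]_(x in A) f x y) \_ B = fun y => \int[mu]_x g (x, y).
  apply/funext => y; rewrite patchE; case: ifPn => yB.
    by rewrite Rintegral_mkcond (gB y yB).
  by rewrite (gBN y yB) Rintegral_cst// mul0r.
have mg : measurable_fun [set: R * R] g.
  by apply/(measurable_restrictT _ _).1 => //; [exact: measurableX|exact: measurable_funS mf].
have i1 x : mu.-integrable [set: R] (fun y => (g (x, y))%:E).
  case: (boolP (x \in A)) => xA.
    rewrite (_ : (fun y => _) = EFin \o (fun y => g (x, y)))// (gA x xA) -restrict_EFin.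
    by apply/integrable_restrict => //; rewrite setTI; apply: f1; rewrite inE in xA.
  by rewrite (_ : (fun y => _) = EFin \o (fun y => g (x, y)))// (gAN x xA);
    exact: integrable0.
have i2 y : mu.-integrable [set: R] (fun x => (g (x, y))%:E).
  case: (boolP (y \in B)) => yB.
    rewrite (_ : (fun x => _) = EFin \o (fun x => g (x, y)))// (gB y yB) -restrict_EFin.
    by apply/integrable_restrict => //; rewrite setTI; apply: f2; rewrite inE in yB.
  by rewrite (_ : (fun x => _) = EFin \o (fun x => g (x, y)))// (gBN y yB);
    exact: integrable0.
have goo : (\int[mu]_y \int[mu]_x `|g (x, y)|%:E < +oo)%E.
  apply: le_lt_trans foo; rewrite le_eqVlt; apply/orP; left; apply/eqP.
  rewrite [RHS]integral_mkcond; apply: eq_integral => y _; rewrite patchE.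
  case: ifPn => yB.
    rewrite [RHS]integral_mkcond; apply: eq_integral => x _.
    rewrite (congr1 (fun k => k x) (gB y yB) : g (x, y) = _) !patchE.
    by case: ifPn => //; rewrite normr0.
  rewrite integral0_eq// => x _.
  by rewrite (congr1 (fun k => k x) (gBN y yB) : g (x, y) = _) /= normr0.
have [iA iB E] := Rintegral_fubini g mg i1 i2 goo.
split.
- have h : mu.-integrable [set: R] ((EFin \o (fun x => \int[mu]_(y in B) f x y)) \_ A).
    by rewrite restrict_EFin EA.
  by have := (integrable_restrict mu mA measurableT _).2 h; rewrite setTI.
- have h : mu.-integrable [set: R] ((EFin \o (fun y => \int[mu]_(x in A) f x y)) \_ B).
    by rewrite restrict_EFin EB.
  by have := (integrable_restrict mu mB measurableT _).2 h; rewrite setTI.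
- by rewrite Rintegral_mkcond EA E [RHS]Rintegral_mkcond EB.
Qed.

(** The form of domination mirrors that assumed for [u_t]: uniform in space, integrable in time. The
    finite measure of [A] makes it sufficient. *)
Lemma Rintegral_fubini_dom (A B : set R) (f : R -> R -> R) (H : R -> R) :
  measurable A -> measurable B -> (mu A < +oo)%E ->
  measurable_fun [set: R * R] (fun z : R * R => f z.1 z.2) ->
  (forall x y, A x -> B y -> `|f x y| <= H y) ->
  mu.-integrable B (EFin \o H) ->
  [/\ mu.-integrable A (EFin \o (fun x => \int[mu]_(y in B) f x y)),
      mu.-integrable B (EFin \o (fun y => \int[mu]_(x in A) f x y)) &
      \int[mu]_(x in A) \int[mu]_(y in B) f x y =
      \int[mu]_(y in B) \int[mu]_(x in A) f x y].
Proof.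
move=> mA mB A_fin mf fH iH; apply: Rintegral_fubini_on => //.
- move=> x Ax; apply: le_integrable iH => //.
    apply/measurable_EFinP; apply: (measurable_funS measurableT) => //.
    exact: (measurable_fun_pair2 x mf).
  by move=> y By; rewrite lee_fin (le_trans (fH _ _ Ax By))// ler_norm.
- move=> y By; apply: measurable_bounded_integrable => //.
    apply: (measurable_funS measurableT) => //.
    exact: (measurable_fun_pair1 y mf).
  exists (H y); split; first exact: num_real.
  by move=> M HM x Ax /=; rewrite (le_trans (fH _ _ Ax By))// ltW.
- have iHA := @EFin_integrableZl _ _ _ mu B (fine (mu A)) H mB iH.
  have mfn : measurable_fun [set: R * R] (fun z : R * R => (`|f z.1 z.2|)%:E).
    by apply/measurable_EFinP; exact: measurableT_comp.
  have hle y : B y -> (\int[mu]_(x in A) `|f x y|%:E <= (fine (mu A) * H y)%:E)%E.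
    move=> By; apply: (@le_trans _ _ (\int[mu]_(x in A) (H y)%:E)%E).
      apply: ge0_le_integral => //.
      - apply: (measurable_funS measurableT) => //.
        exact: (measurable_fun_pair1 y mfn).
      - by move=> x Ax; rewrite lee_fin fH.
    by rewrite integral_cst// mulrC EFinM fineK// ge0_fin_numE.
  case/integrableP : iHA => mHA; apply: le_lt_trans.
  apply: ge0_le_integral => //.
  - by move=> y By; exact: integral_ge0.
  (* Comparing the integrals needs the inner one to be measurable in [y]; Tonelli gives this for the
     function cut off to [A] in its first variable. *)
  - pose F := (fun z : R * R => `|f z.1 z.2|%:E) \_ (A `*` [set: R]).
    have mF : measurable_fun [set: R * R] F.
      by apply/(measurable_restrictT _ _).1 => //; [exact: measurableX|exact: measurable_funS mfn].
    have F0 z : (0 <= F z)%E by rewrite /F patchE; case: ifP.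
    apply: (measurable_funS measurableT) => //.
    have := measurable_fun_fubini_tonelli_G (m1 := mu) F mF F0.
    rewrite (_ : fubini_G _ _ = fun y => (\int[mu]_(x in A) `|f x y|%:E)%E)//.
    apply/funext => y; rewrite /fubini_G [RHS]integral_mkcond.
    apply: eq_integral => x _; rewrite /F !patchE.
    rewrite (_ : ((x, y) \in A `*` [set: R]) = (x \in A))//.
    by apply/idP/idP; rewrite !inE => // -[].
  - exact: measurableT_comp.
  - by move=> y By; rewrite (le_trans (hle y By))//= lee_fin ler_norm.
Qed.

End fubini_on.

(** * Composition of the two fractional integrals *)

Section abel_convolution.
Context {R : realType}.
Notation mu := (@lebesgue_measure R).

(** The semigroup law: fractional integrals of orders [nu] and [1 - nu] compose to the ordinary
    integral, [beta_abel nu] standing in for the omitted Gamma factors. *)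
Lemma abel_convolution (nu t : R) (P : R -> R) : 0 < nu < 1 -> 0 < t ->
  mu.-integrable `]0, t[ (EFin \o P) ->
  (forall s : R, 0 < s < t ->
    mu.-integrable `]0, s[ (EFin \o (fun r => (s - r) `^ (- nu) * P r))) ->
  mu.-integrable `]0, t[ (EFin \o (fun s => (t - s) `^ (nu - 1) *
    \int[mu]_(r in `]0, s[) ((s - r) `^ (- nu) * P r))) /\
  \int[mu]_(s in `]0, t[) ((t - s) `^ (nu - 1) *
    \int[mu]_(r in `]0, s[) ((s - r) `^ (- nu) * P r)) =
  beta_abel nu * \int[mu]_(r in `]0, t[) P r.
Proof.
move=> nu01 t0 iP isP.
pose I : set R := `]0, t[%classic.
have mI : measurable I by exact: measurable_itv.
(* The guard encodes the triangle of integration and removes the junk values of the kernel;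
   restricting [P] makes [f] measurable on the whole plane. *)
pose f s r := if r < s then abel_kernel nu t r s * (P \_ I) r else 0.
have mP : measurable_fun [set: R] (P \_ I).
  apply/(measurable_restrictT _ _).1; first exact: measurable_itv.
  by apply/measurable_EFinP; case/integrableP : iP.
have mf : measurable_fun [set: R * R] (fun z : R * R => f z.1 z.2).
  apply: measurable_fun_ifT; last exact: measurable_cst.
    by apply: measurable_fun_ltr; [exact: measurable_snd|exact: measurable_fst].
  apply: measurable_funM.
    apply: measurable_funM.
      apply: (@measurable_fun_powR _ _ _ _ (fun z : R * R => t - z.1)).
      by apply: measurable_funB; [exact: measurable_cst|exact: measurable_fst].
    apply: (@measurable_fun_powR _ _ _ _ (fun z : R * R => z.1 - z.2)).
    by apply: measurable_funB; [exact: measurable_fst|exact: measurable_snd].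
  exact: (measurableT_comp mP measurable_snd).
have fs s : I s -> {in I, f s =1
    (fun r => (t - s) `^ (nu - 1) * ((s - r) `^ (- nu) * P r)) \_ `]0, s[}.
  rewrite /I /= in_itv/= => /andP[s0 st] r; rewrite inE /I/= in_itv/= => /andP[r0 rt].
  rewrite /f !patchE mem_set /I /= ?in_itv/= ?r0 ?rt//; case: ifPn => rs.
    by rewrite mem_set /= ?in_itv/= ?r0 ?rs// /abel_kernel mulrA.
  by rewrite memNset //= in_itv/= r0 (negbTE rs).
have fr r : I r -> {in I, f^~ r =1 (fun s => abel_kernel nu t r s * P r) \_ `]r, t[}.
  rewrite /I /= in_itv/= => /andP[r0 rt] s; rewrite inE /I/= in_itv/= => /andP[s0 st].
  rewrite /f !patchE mem_set /I /= ?in_itv/= ?r0 ?rt//; case: ifPn => rs.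
    by rewrite mem_set /= ?in_itv/= ?st ?rs.
  by rewrite memNset //= in_itv/= (negbTE rs).
have subs s : I s -> I `&` `]0, s[%classic = `]0, s[%classic.
  rewrite /I /= in_itv/= => /andP[s0 st]; apply/setIidr; apply: subset_itvl.
  by rewrite bnd_simp ltW.
have subr r : I r -> I `&` `]r, t[%classic = `]r, t[%classic.
  rewrite /I /= in_itv/= => /andP[r0 rt]; apply/setIidr; apply: subset_itvr.
  by rewrite bnd_simp ltW.
have f1 s : I s -> mu.-integrable I (EFin \o f s).
  move=> Is; have := fs s Is => fE.
  apply: (@eq_integrable _ _ _ mu I mI (EFin \o
    ((fun r => (t - s) `^ (nu - 1) * ((s - r) `^ (- nu) * P r)) \_ `]0, s[))).
    by move=> r Ir; rewrite /= fE.
  rewrite -restrict_EFin; apply/integrable_restrict => //; rewrite subs//.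
  by apply: EFin_integrableZl => //; apply: isP; move: Is; rewrite /I /= in_itv.
have beta_fin r : I r -> mu.-integrable `]r, t[ (EFin \o abel_kernel nu t r).
  rewrite /I /= in_itv/= => /andP[r0 rt]; apply/integrableP; split.
    by apply/measurable_EFinP; exact: measurable_abel_kernel.
  apply: (@le_lt_trans _ _ (beta_abel nu)%:E); last exact: ltry.
  rewrite -(integral_abel_kernel _ nu01 _ _ rt) le_eqVlt; apply/orP; left; apply/eqP.
  by apply: eq_integral => s _; rewrite /= ger0_norm// abel_kernel_ge0.
have iK r : I r -> mu.-integrable `]r, t[ (EFin \o (fun s => abel_kernel nu t r s * P r)).
  move=> Ir; have := EFin_integrableZl _ _ mu _ (P r) _ (measurable_itv _) (beta_fin r Ir).
  by rewrite (_ : (fun x => P r * _) = fun s => abel_kernel nu t r s * P r)//;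
    apply/funext => s; rewrite mulrC.
have f2 r : I r -> mu.-integrable I (EFin \o f^~ r).
  move=> Ir; have := fr r Ir => fE.
  apply: (@eq_integrable _ _ _ mu I mI (EFin \o
    ((fun s => abel_kernel nu t r s * P r) \_ `]r, t[))).
    by move=> s Is; rewrite /= fE.
  by rewrite -restrict_EFin; apply/integrable_restrict => //; rewrite subr//; exact: iK.
(* Integrating in [s] first turns the nonnegative kernel into the constant [beta_abel nu], leaving
   the integral of [|P|]. *)
have foo : (\int[mu]_(r in I) \int[mu]_(s in I) `|f s r|%:E < +oo)%E.
  have /integrableP[_] := EFin_integrableZl _ _ mu _ (beta_abel nu) _ mI iP.
  apply: le_lt_trans; rewrite le_eqVlt; apply/orP; left; apply/eqP.
  apply: eq_integral => r; rewrite inE => Ir.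
  transitivity (\int[mu]_(s in `]r, t[) (`|P r|%:E * (abel_kernel nu t r s)%:E))%E.
    rewrite -(subr r Ir) integral_mkcondr; apply: eq_integral => s Is.
    rewrite (fr r Ir s Is) !patchE; case: ifPn => _; last by rewrite normr0.
    by rewrite normrM ger0_norm ?abel_kernel_ge0// mulrC EFinM.
  rewrite ge0_integralZl//.
  - rewrite (integral_abel_kernel _ nu01); last by move: Ir; rewrite /I /= in_itv/= => /andP[].
    by rewrite -EFinM /= normrM mulrC ger0_norm// ltW// beta_abel_gt0.
  - by apply/measurable_EFinP; exact: measurable_abel_kernel.
  - by move=> s _; rewrite lee_fin abel_kernel_ge0.
have [i1 i2 E] := Rintegral_fubini_on I I f mI mI mf f1 f2 foo.
have E1 s : I s -> \int[mu]_(r in I) f s r =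
    (t - s) `^ (nu - 1) * \int[mu]_(r in `]0, s[) ((s - r) `^ (- nu) * P r).
  move=> Is; have is1 : mu.-integrable `]0, s[ (EFin \o (fun r => (s - r) `^ (- nu) * P r)).
    by apply: isP; move: Is; rewrite /I /= in_itv.
  rewrite -(@RintegralZl _ _ _ mu _ _ _ (measurable_itv _) is1).
  rewrite -[in RHS](subs s Is) Rintegral_mkcondr.
  by apply: eq_Rintegral => r rI; rewrite (fs s Is r rI).
have E2 r : I r -> \int[mu]_(s in I) f s r = beta_abel nu * P r.
  move=> Ir; transitivity (\int[mu]_(s in `]r, t[) (abel_kernel nu t r s * P r)).
    rewrite -(subr r Ir) Rintegral_mkcondr.
    by apply: eq_Rintegral => s sI; rewrite (fr r Ir s sI).
  rewrite (@RintegralZr _ _ _ mu _ _ _ (measurable_itv _) (beta_fin r Ir)).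
  rewrite {1}/Rintegral (integral_abel_kernel _ nu01)//.
  by move: Ir; rewrite /I /= in_itv/= => /andP[].
split.
  apply: (@eq_integrable _ _ _ mu I mI _ _ _ i1) => s; rewrite inE => Is.
  by rewrite /= E1.
rewrite -(@RintegralZl _ _ _ mu _ _ _ mI iP).
transitivity (\int[mu]_(s in I) \int[mu]_(r in I) f s r).
  by apply: eq_Rintegral => s; rewrite inE => Is; rewrite E1.
rewrite E; apply: eq_Rintegral => r; rewrite inE => Ir; exact: E2.
Qed.

End abel_convolution.

(** * The fractional energy inequality in time, with [w] and [p] standing for [u] and [u_t] *)

Section fractional.
Context {R : realType}.
Notation mu := (@lebesgue_measure R).
Variables (nu T A : R) (w p : R -> R -> R) (h : R -> R).
Hypothesis nu01 : 0 < nu < 1.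
Hypothesis wx_continuous : forall t, continuous (w^~ t).
Hypothesis wt_continuous : forall x, continuous (w x).
Hypothesis w_bounded : forall x t, `|w x t| <= A.
Hypothesis px_continuous : forall t, continuous (p^~ t).
Hypothesis pt_measurable : forall x, measurable_fun [set: R] (p x).
Hypothesis pt_continuous : forall x t : R, 0 < t < T -> {for t, continuous (p x)}.
Hypothesis w_derive : forall x t : R, 0 < t < T -> is_derive t 1 (w x) (p x t).
Hypothesis h_integrable : mu.-integrable `]0, T[ (EFin \o h).
Hypothesis p_dominated : forall x t : R, 0 < t < T -> `|p x t| <= h t.
Hypothesis p_locally_bounded : forall s : R, 0 < s < T ->
  exists C, forall x r : R, s / 2 <= r <= s -> `|p x r| <= C.

Let A0 : 0 <= A. Proof. exact: le_trans (normr_ge0 _) (w_bounded 0 0). Qed.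

Let w_measurable : measurable_fun [set: R * R] (fun z : R * R => w z.1 z.2).
Proof.
apply: measurable_fun_caratheodory => // x.
exact: continuous_measurable_fun.
Qed.

Let p_measurable : measurable_fun [set: R * R] (fun z : R * R => p z.1 z.2).
Proof. exact: measurable_fun_caratheodory. Qed.

(* [p] may be singular at [0] and the kernel is singular at [s]: use the bound [h]
   on the first half of the interval and local boundedness of [p] on the second. *)
Lemma memory_dominated (s : R) : 0 < s < T ->
  exists2 H : R -> R, mu.-integrable `]0, s[ (EFin \o H) &
    forall x r, 0 < r < s -> `|p x r * (s - r) `^ (- nu)| <= H r.
Proof.
move=> /andP[s0 sT]; have /andP[nu0 nu1] := nu01.
have [C pC] := p_locally_bounded s (introT andP (conj s0 sT)).
exists (fun r => (s / 2) `^ (- nu) * h r + `|C| * (s - r) `^ (- nu)).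
  apply: EFin_integrableD => //; apply: EFin_integrableZl => //.
    apply: integrableS h_integrable => //; apply: subset_itvl.
    by rewrite bnd_simp ltW.
  by apply: integrable_powRBr; lra.
move=> x r /andP[r0 rs].
have rT : 0 < r < T by rewrite r0 (lt_trans rs).
have ph := p_dominated x r rT.
have h0 : 0 <= h r by exact: le_trans (normr_ge0 _) ph.
rewrite normrM (ger0_norm (powR_ge0 _ _)); have [rs2|rs2] := leP r (s / 2).
  rewrite -[leLHS]addr0 lerD// ?mulr_ge0 ?powR_ge0// mulrC ler_pM ?powR_ge0//.
  by apply: powR_le_neg; lra.
rewrite -[leLHS]add0r lerD// ?mulr_ge0 ?powR_ge0// ler_wpM2r ?powR_ge0//.
rewrite (le_trans (pC x r _)) ?ler_norm//.
by rewrite !ltW.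
Qed.

Lemma integrable_memory (s x : R) : 0 < s < T ->
  mu.-integrable `]0, s[ (EFin \o (fun r => p x r * (s - r) `^ (- nu))).
Proof.
move=> sT; have [H iH pH] := memory_dominated s sT.
apply: le_integrable iH => //.
  apply/measurable_EFinP; apply: measurable_funM.
    by apply: (measurable_funS measurableT) => //; exact: pt_measurable.
  by apply: measurable_fun_powR; exact: measurable_funB.
move=> r; rewrite /= in_itv/= => r0s; rewrite lee_fin.
by rewrite (le_trans (pH x r r0s))// ler_norm.
Qed.

(** Dominated convergence, the majorant being uniform in [x]. Through the equation this continuity
    passes to the derivative of the flux, as integration by parts demands. *)
Lemma continuous_memory (s : R) : 0 < s < T ->
  continuous (fun x => \int[mu]_(r in `]0, s[) (p x r * (s - r) `^ (- nu))).
Proof.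
move=> sT x; have [H iH pH] := memory_dominated s sT.
apply: (@continuity_under_integral R _ _ mu
  (fun x r => p x r * (s - r) `^ (- nu)) `]0, s[ (measurable_itv _)
  (x - 1) (x + 1) _ _ H iH).
- by move=> y _; exact: integrable_memory.
- apply: aeW => r _ y _; apply: cvgM; last exact: cvg_cst.
  exact: px_continuous.
- move=> y _; apply: aeW => r; rewrite /= in_itv/=; exact: pH.
- by rewrite inE/= in_itv/=; apply/andP; split; lra.
Qed.

(** Formally half the time derivative of the squared norm of [w], but used only through its
    integrals. *)
Let P (r : R) : R := \int[mu]_(x in `[0, 1]) (w x r * p x r).

Lemma energy_memory_le (s : R) : 0 < s < T ->
  mu.-integrable `]0, s[ (EFin \o (fun r => (s - r) `^ (- nu) * P r)) /\
  \int[mu]_(r in `]0, s[) ((s - r) `^ (- nu) * P r) <=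
  \int[mu]_(x in `[0, 1])
    (w x s * \int[mu]_(r in `]0, s[) (p x r * (s - r) `^ (- nu))).
Proof.
move=> sT; have [H iH pH] := memory_dominated s sT.
have /andP[s0 sT'] := sT.
have [||||||i1 i2 E] := @Rintegral_fubini_dom R `[0, 1] `]0, s[
  (fun x r => w x r * (p x r * (s - r) `^ (- nu))) (fun r => A * H r).
- exact: measurable_itv.
- exact: measurable_itv.
- by rewrite /= lebesgue_measure_itv/= lte_fin ltr01 -EFinB ltry.
- rewrite /=; apply: measurable_funM => //; apply: measurable_funM => //.
  apply: (@measurable_fun_powR _ _ _ _ (fun z : R * R => s - z.2)).
  by apply: measurable_funB => //; exact: measurable_snd.
- move=> x r _; rewrite /= in_itv/= => rs.
  by rewrite normrM ler_pM// pH.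
- exact: EFin_integrableZl.
have PE r : \int[mu]_(x in `[0, 1]) (w x r * (p x r * (s - r) `^ (- nu))) =
    (s - r) `^ (- nu) * P r.
  have iwp : mu.-integrable `[0, 1] (EFin \o (fun x => w x r * p x r)).
    apply: continuous_integrable01 => x.
    by apply: cvgM; [exact: wx_continuous|exact: px_continuous].
  rewrite /P -(@RintegralZl _ _ _ mu _ _ _ (measurable_itv _) iwp).
  by apply: eq_Rintegral => x _; ring.
have {}PE := funext PE.
split; first by move: i2; rewrite PE.
have E' := etrans (congr1 (fun k => \int[mu]_(r in `]0, s[) k r) (esym PE)) (esym E).
apply: (le_trans (eq_ind _ (fun y => y <= _) (lexx _) _ (esym E'))).
apply: (@le_Rintegral _ _ _ mu `[0, 1]
  (fun x => \int[mu]_(r in `]0, s[) (w x r * (p x r * (s - r) `^ (- nu))))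
  (fun x => w x s * \int[mu]_(r in `]0, s[) (p x r * (s - r) `^ (- nu)))
  (measurable_itv _) i1).
  apply: continuous_integrable01 => x.
  by apply: cvgM; [exact: wx_continuous|exact: continuous_memory].
move=> x _; apply: (@alikhanov_inequality R nu s (w x) (p x) nu01 s0).
- exact: continuous_subspaceT.
- by move=> r /andP[r0 rs]; apply: w_derive; rewrite r0 (le_lt_trans rs).
- by move=> r /andP[r0 rs]; apply: pt_continuous; rewrite r0 (lt_trans rs).
- exact: integrable_memory.
- have iAH := EFin_integrableZl _ _ mu _ A _ (measurable_itv _) iH.
  apply: le_integrable iAH; first exact: measurable_itv.
    apply/measurable_EFinP; apply: measurable_funM.
      by apply: measurable_funTS; exact: continuous_measurable_fun.
    have /integrableP[mpK _] := integrable_memory s x sT.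
    by apply/measurable_EFinP; exact: mpK.
  move=> r; rewrite /= in_itv/= => rs; rewrite lee_fin.
  apply: le_trans (ler_norm _); rewrite normrM.
  exact: ler_pM (normr_ge0 _) (normr_ge0 _) (w_bounded x r) (pH x r rs).
Qed.

(** Exchanging the integrals replaces differentiation under the integral sign: for fixed [x],
    [w * p] is the derivative of half of [w ^+ 2]. The open-interval theorem is needed since [p] may
    be singular at 0 and is not controlled at [T]. *)
Lemma Rintegral_power (t : R) : 0 < t <= T ->
  mu.-integrable `]0, t[ (EFin \o P) /\
  \int[mu]_(r in `]0, t[) P r =
  2^-1 * (\int[mu]_(x in `[0, 1]) w x t ^+ 2 - \int[mu]_(x in `[0, 1]) w x 0 ^+ 2).
Proof.
move=> /andP[t0 tT].
have ih : mu.-integrable `]0, t[ (EFin \o h).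
  by apply: integrableS h_integrable => //; apply: subset_itvl; rewrite bnd_simp.
have [||||||i1 i2 E] := @Rintegral_fubini_dom R `[0, 1] `]0, t[
  (fun x r => w x r * p x r) (fun r => A * h r).
- exact: measurable_itv.
- exact: measurable_itv.
- by rewrite /= lebesgue_measure_itv/= lte_fin ltr01 -EFinB ltry.
- exact: measurable_funM.
- move=> x r _; rewrite /= in_itv/= => /andP[r0 rt].
  by rewrite normrM ler_pM// p_dominated// r0 (lt_le_trans rt).
- exact: EFin_integrableZl.
split=> //; rewrite /P -E.
have cw2 r : continuous (fun x => w x r ^+ 2).
  by move=> x; apply: cvgM; exact: wx_continuous.
have iw2 r := continuous_integrable01 _ (cw2 r).
rewrite -(@RintegralB _ _ _ mu _ _ _ (measurable_itv _) (iw2 t) (iw2 0)).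
have iw := EFin_integrableB _ _ mu _ _ _ (measurable_itv _) (iw2 t) (iw2 0).
rewrite -(@RintegralZl _ _ _ mu _ _ _ (measurable_itv _) iw).
apply: eq_Rintegral => x; rewrite inE/= in_itv/= => x01.
have dw r : 0 < r < t -> is_derive r 1 (w x) (p x r).
  by move=> /andP[r0 rt]; apply: w_derive; rewrite r0 (lt_le_trans rt).
rewrite mulrBr; apply: (@Rintegral_oo_derive R (fun r => 2^-1 * w x r ^+ 2)
  (fun r => w x r * p x r) 0 t (ltW t0)).
- apply: continuous_subspaceT => r; apply: cvgM; first exact: cvg_cst.
  by apply: cvgM; exact: wt_continuous.
- move=> r rt; have d := dw r rt.
  apply: (is_derive_eq (is_deriveZ 2^-1 (is_deriveM d d))).
  by rewrite /GRing.scale/=; field.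
- move=> r /andP[r0 rt]; apply: cvgM; first exact: wt_continuous.
  by apply: pt_continuous; rewrite r0 (lt_le_trans rt).
- have iAh := EFin_integrableZl _ _ mu _ A _ (measurable_itv _) ih.
  apply: le_integrable iAh; first exact: measurable_itv.
    apply/measurable_EFinP; apply: measurable_funTS.
    apply: measurable_funM; last exact: pt_measurable.
    exact: continuous_measurable_fun.
  move=> r; rewrite /= in_itv/= => /andP[r0 rt]; rewrite lee_fin.
  have ph : `|p x r| <= h r by apply: p_dominated; rewrite r0 (lt_le_trans rt).
  apply: le_trans (ler_norm _); rewrite normrM.
  exact: ler_pM (normr_ge0 _) (normr_ge0 _) (w_bounded x r) ph.
Qed.

(** Only times [s < t] are integrated, so bounds strictly before [T] suffice even for [t = T]. *)
Lemma fractional_energy_le (E : R -> R) (t : R) : 0 < t <= T ->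
  (forall s : R, 0 < s < T ->
    \int[mu]_(x in `[0, 1])
      (w x s * \int[mu]_(r in `]0, s[) (p x r * (s - r) `^ (- nu))) <= E s) ->
  mu.-integrable `]0, t[ (EFin \o (fun s => (t - s) `^ (nu - 1) * E s)) ->
  beta_abel nu / 2 *
    (\int[mu]_(x in `[0, 1]) w x t ^+ 2 - \int[mu]_(x in `[0, 1]) w x 0 ^+ 2) <=
  \int[mu]_(s in `]0, t[) ((t - s) `^ (nu - 1) * E s).
Proof.
move=> tT wE iE; have /andP[t0 tT'] := tT.
have sT s : 0 < s < t -> 0 < s < T.
  by move=> /andP[s0 st]; rewrite s0 (lt_le_trans st).
have [iP EP] := Rintegral_power t tT.
have [iA EA] := abel_convolution nu t P nu01 t0 iP
  (fun s st => (energy_memory_le s (sT s st)).1).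
rewrite -mulrA -EP -EA.
apply: (@le_Rintegral _ _ _ mu `]0, t[
  (fun s => (t - s) `^ (nu - 1) * \int[mu]_(r in `]0, s[) ((s - r) `^ (- nu) * P r))
  (fun s => (t - s) `^ (nu - 1) * E s) (measurable_itv _) iA iE).
move=> s; rewrite /= in_itv/= => st; rewrite ler_wpM2l ?powR_ge0//.
exact: le_trans (energy_memory_le s (sT s st)).2 (wE s (sT s st)).
Qed.

End fractional.

(** * Global extensions of functions given on the space-time rectangle *)

Section clamp.
Context {R : realType}.
Notation mu := (@lebesgue_measure R).

Definition clamp (b x : R) : R := Num.max 0 (Num.min b x).

Lemma clamp_itv (b x : R) : 0 <= b -> 0 <= clamp b x <= b.
Proof. by move=> b0; rewrite /clamp le_max lexx ge_max b0 ge_min lexx. Qed.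

Lemma clamp_id (b x : R) : 0 <= x <= b -> clamp b x = x.
Proof. by move=> /andP[x0 xb]; rewrite /clamp min_r// max_r. Qed.

Lemma clamp_lipschitz (b x y : R) : 0 <= b -> `|clamp b x - clamp b y| <= `|x - y|.
Proof.
move=> b0; have h1 := ler_norm (x - y).
have h2 : y - x <= `|x - y| by rewrite distrC ler_norm.
have h3 := normr_ge0 (x - y).
rewrite ler_norml; set N := `|x - y| in h1 h2 h3 *.
rewrite /clamp; case: (leP b x) => bx; case: (leP b y) => by_;
  rewrite ?(max_r b0); case: (leP 0 x) => ?; case: (leP 0 y) => ?;
  apply/andP; split; lra.
Qed.

Lemma continuous_clamp (b : R) : 0 <= b -> continuous (clamp b).
Proof.
move=> b0 x; apply/cvgrPdist_lt => e e0; near=> y.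
apply: (le_lt_trans (clamp_lipschitz b x y b0)).
by near: y; exact: (cvgr_dist_lt _ _ cvg_id).
Unshelve. all: by end_near. Qed.

(** Turns continuity relative to [D] into ordinary continuity along any map that stays in [D] near
    the point. *)
Lemma cvg_within_comp (S T U : topologicalType) (D : set T) (f : T -> U) (g : S -> T)
    (x : S) :
  {within D, continuous f} -> {for x, continuous g} -> D (g x) ->
  (\forall y \near x, D (g y)) -> f (g y) @[y --> x] --> f (g x).
Proof.
move=> /subspace_continuousP cf cg Dgx Dg.
apply: (@cvg_comp _ _ _ g f _ _ _ _ (cf _ Dgx)).
move=> P /= wP; have := cg _ wP; rewrite /= => h.
by apply: filterS2 h Dg => y; apply.
Qed.

Lemma continuous_within_comp (S T U : topologicalType) (D : set T) (f : T -> U)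
    (g : S -> T) :
  {within D, continuous f} -> continuous g -> (forall x, D (g x)) ->
  continuous (fun x => f (g x)).
Proof.
move=> cf cg Dg x; apply: (cvg_within_comp S T U D f g x cf (cg x) (Dg x)).
exact: nearW.
Qed.

Lemma within_bounded (T : topologicalType) (D : set T) (f : T -> R) :
  {within D, continuous f} -> compact D -> exists A, forall x, D x -> `|f x| <= A.
Proof.
move=> cf cD; have [M [_ fM]] := compact_bounded (continuous_compact cf cD).
by exists (M + 1) => x Dx; apply: fM; [rewrite ltrDl|exists x].
Qed.

(* Clamping the variables turns functions controlled only on [0, 1] x [0, T] into
   globally continuous ones, so that no relative topologies are needed below. *)
Definition extend (T : R) (f : R -> R -> R) (x t : R) : R := f (clamp 1 x) (clamp T t).

Section extend.
Variables (T : R) (f : R -> R -> R).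
Hypothesis T0 : 0 <= T.
Hypothesis cf : continuous_on2 (`[0, 1] `*` `[0, T]) f.

Let inD x t : (`[0, 1] `*` `[0, T])%classic (clamp 1 x, clamp T t).
Proof. by split; rewrite /= in_itv/=; apply: clamp_itv. Qed.

Lemma extend_continuousl (t : R) : continuous (extend T f ^~ t).
Proof.
apply: (continuous_within_comp R (R * R)%type R _ (fun z : R * R => f z.1 z.2)
  (fun x => (clamp 1 x, clamp T t)) cf) => // x.
exact: (cvg_pair (continuous_clamp 1 ler01 x) (cvg_cst (clamp T t))).
Qed.

Lemma extend_continuousr (x : R) : continuous (extend T f x).
Proof.
apply: (continuous_within_comp R (R * R)%type R _ (fun z : R * R => f z.1 z.2)
  (fun t => (clamp 1 x, clamp T t)) cf) => // t.
exact: (cvg_pair (cvg_cst (clamp 1 x)) (continuous_clamp T T0 t)).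
Qed.

Lemma extend_bounded : exists A, forall x t, `|extend T f x t| <= A.
Proof.
have [] := within_bounded _ _ _ cf.
  by apply: compact_setX; exact: segment_compact.
by move=> A fA; exists A => x t; exact: (fA _ (inD x t)).
Qed.

End extend.

Lemma extend_id (T : R) (f : R -> R -> R) (x t : R) :
  0 <= x <= 1 -> 0 <= t <= T -> extend T f x t = f x t.
Proof. by move=> x01 tT; rewrite /extend !clamp_id. Qed.

(** Near an interior point the constraint to [0, 1] is vacuous; the difference quotient completed by
    its limit is then a Caratheodory slope. *)
Lemma derive01_interior (g : R -> R) (x : R) : 0 < x < 1 -> derivable01 g x ->
  is_derive x 1 g (derive01 g x).
Proof.
move=> x01; rewrite /derivable01 => dg; set l := derive01 g x.
have {}dg : diff_quot g x y @[y --> x^'] --> l.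
  move=> P /dg; rewrite /= /within/= => wP.
  have nx : \forall y \near x, y \in `]0, 1[ by apply: near_in_itvoo; rewrite in_itv.
  apply: (@filterS2 _ (nbhs x) _ _ _ _ _ wP nx) => y /= h y01 yx; apply: h => //.
  by rewrite in_itv/=; move: y01; rewrite in_itv/= => /andP[? ?]; rewrite !ltW.
apply/is_derive1_caratheodory.
exists (fun z => if z == x then l else diff_quot g x z); split.
- move=> z; case: eqVneq => [->|zx]; first by rewrite !subrr mulr0.
  by rewrite /diff_quot divfK// subr_eq0.
- apply/continuous_withinNx; rewrite eqxx.
  apply: cvg_trans dg; apply: near_eq_cvg; near=> z.
  rewrite ifF//; apply/negbTE; near: z; exact: nbhs_dnbhs_neq.
- by rewrite eqxx.
Unshelve. all: by end_near. Qed.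

Lemma integrable_powRBr_bounded (nu t A : R) (B : R -> R) : 0 < nu ->
  measurable_fun [set: R] B -> (forall s, `|B s| <= A) ->
  mu.-integrable `]0, t[ (EFin \o (fun s => (t - s) `^ (nu - 1) * B s)).
Proof.
move=> nu0 mB BA; have nu1 : -1 < nu - 1 by lra.
have iA := EFin_integrableZl _ _ mu _ A _ (measurable_itv _) (integrable_powRBr 0 t _ nu1).
apply: le_integrable iA; first exact: measurable_itv.
  apply/measurable_EFinP; apply: measurable_funTS; apply: measurable_funM => //.
  apply: (@measurable_fun_powR _ _ _ _ (fun s : R => t - s)).
  by apply: measurable_funB; [exact: measurable_cst|exact: measurable_id].
move=> s _; rewrite lee_fin; apply: le_trans (ler_norm _).
by rewrite normrM ger0_norm ?powR_ge0// mulrC ler_wpM2r ?powR_ge0.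
Qed.

(** Measurability and boundedness in time are what integrability against the singular
    Riemann-Liouville weight requires. *)
Lemma sqnorm_param (A : R) (f : R -> R -> R) :
  (forall t, continuous (f^~ t)) -> (forall x, continuous (f x)) ->
  (forall x t, `|f x t| <= A) ->
  measurable_fun [set: R] (fun t => \int[mu]_(x in `[0, 1]) f x t ^+ 2) /\
  (forall t, `|\int[mu]_(x in `[0, 1]) f x t ^+ 2| <= A ^+ 2).
Proof.
move=> cx ct fA; have A0 : 0 <= A := le_trans (normr_ge0 _) (fA 0 0).
have f2A x t : `|f x t ^+ 2| <= A ^+ 2.
  by rewrite normrX lerXn2r ?nnegrE.
have cx2 t : continuous (fun x => f x t ^+ 2) by move=> x; apply: cvgM; exact: cx.
have iA : mu.-integrable `[0, 1] (EFin \o (fun=> A ^+ 2)).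
  by apply: continuous_integrable01 => x; exact: cvg_cst.
split.
  apply: continuous_measurable_fun => t.
  apply: (@continuity_under_integral R _ _ mu (fun t x => f x t ^+ 2) `[0, 1]
    (measurable_itv _) (t - 1) (t + 1) _ _ (fun=> A ^+ 2) iA).
  - by move=> s _; exact: continuous_integrable01.
  - by apply: aeW => x _ s _; apply: cvgM; exact: ct.
  - by move=> s _; apply: aeW => x _.
  - by rewrite inE/= in_itv/=; apply/andP; split; lra.
move=> t; rewrite ger0_norm; last by apply: Rintegral_ge0 => x _; exact: sqr_ge0.
apply: (@le_trans _ _ (\int[mu]_(x in `[0, 1]) A ^+ 2)).
  apply: (@le_Rintegral _ _ _ mu `[0, 1] (fun x => f x t ^+ 2) (fun=> A ^+ 2)
    (measurable_itv _) _ iA); first exact: continuous_integrable01.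
  by move=> x _; rewrite (le_trans (ler_norm _)).
by rewrite Rintegral_cst//= lebesgue_measure_itv/= lte_fin ltr01 oppr0 adde0/= mulr1.
Qed.

End clamp.

(** * Extension of the time derivative *)

Section dt_extend.
Context {R : realType}.
Notation mu := (@lebesgue_measure R).

(** Space is clamped, but time is cut off by zero: [u_t] is controlled on the open interval only and
    may have no limit at 0, so clamping [t] would evaluate it at a meaningless endpoint. *)
Definition dt_extend (T : R) (u : R -> R -> R) (x : R) : R -> R :=
  pdt u (clamp 1 x) \_ `]0, T[.

Variables (T : R) (u : R -> R -> R).
Hypothesis cpdt : continuous_on2 (`[0, 1] `*` `]0, T[) (pdt u).

Lemma dt_extend_id (x t : R) : 0 < t < T -> dt_extend T u x t = pdt u (clamp 1 x) t.
Proof. by move=> tT; rewrite /dt_extend patchE mem_set//= in_itv. Qed.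

Let inD (x t : R) : 0 < t < T -> (`[0, 1] `*` `]0, T[)%classic (clamp 1 x, t).
Proof. by move=> tT; split; rewrite /= in_itv//=; apply: clamp_itv. Qed.

Lemma dt_extend_continuousl (t : R) : continuous (dt_extend T u ^~ t).
Proof.
case: (boolP (0 < t < T)) => tT.
  rewrite (_ : dt_extend T u ^~ t = fun x => pdt u (clamp 1 x) t); last first.
    by apply/funext => x; rewrite dt_extend_id.
  apply: (continuous_within_comp R (R * R)%type R _ (fun z : R * R => pdt u z.1 z.2)
    (fun x => (clamp 1 x, t)) cpdt) => [x|x]; last exact: inD.
  exact: (cvg_pair (continuous_clamp 1 ler01 x) (cvg_cst t)).
rewrite (_ : dt_extend T u ^~ t = fun=> 0); first by move=> x; exact: cvg_cst.
by apply/funext => x; rewrite /dt_extend patchE memNset//= in_itv/=; exact/negP.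
Qed.

Let pdt_continuous (x t : R) : 0 < t < T ->
  {for t, continuous (fun t => pdt u (clamp 1 x) t)}.
Proof.
move=> tT; have nt : \forall s \near t, s \in `]0, T[.
  by apply: near_in_itvoo; rewrite in_itv.
apply: (cvg_within_comp R (R * R)%type R _ (fun z : R * R => pdt u z.1 z.2)
  (fun t => (clamp 1 x, t)) t cpdt _ (inD x t tT)).
- exact: (cvg_pair (cvg_cst (clamp 1 x)) cvg_id).
- by apply: filterS nt => s; rewrite in_itv/=; exact: inD.
Qed.

Lemma dt_extend_continuousr (x t : R) : 0 < t < T ->
  {for t, continuous (dt_extend T u x)}.
Proof.
move=> tT; rewrite /prop_for /continuous_at dt_extend_id//.
apply: cvg_trans (pdt_continuous x t tT); apply: near_eq_cvg.
have nt : \forall s \near t, s \in `]0, T[ by apply: near_in_itvoo; rewrite in_itv.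
by apply: filterS nt => s; rewrite in_itv/= => sT; rewrite dt_extend_id.
Qed.

Lemma dt_extend_measurable (x : R) : measurable_fun [set: R] (dt_extend T u x).
Proof.
apply/(measurable_restrictT _ _).1; first exact: measurable_itv.
apply: open_continuous_measurable_fun => //.
by move=> t; rewrite inE/= in_itv/=; exact: pdt_continuous.
Qed.

Lemma dt_extend_locally_bounded (s : R) : 0 < s < T ->
  exists C, forall x r : R, s / 2 <= r <= s -> `|dt_extend T u x r| <= C.
Proof.
move=> /andP[s0 sT].
have sub : `[0, 1] `*` `[s / 2, s] `<=` (`[0, 1] `*` `]0, T[ : set (R * R)).
  move=> [x r] /= [x01]; rewrite !in_itv/= => /andP[r1 r2]; split => //.
  by apply/andP; split; lra.
have [] := within_bounded _ _ _ (continuous_subspaceW sub cpdt).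
  by apply: compact_setX; exact: segment_compact.
move=> C uC; exists C => x r sr.
have rT : 0 < r < T by move: sr => /andP[r1 r2]; apply/andP; split; lra.
rewrite dt_extend_id//; apply: (uC (clamp 1 x, r)).
by split; rewrite /= in_itv//=; apply: clamp_itv.
Qed.

End dt_extend.

(** * Application to the solution *)

Section estimate.
Context {R : realType}.
Notation mu := (@lebesgue_measure R).

Lemma near_itvoo (a b x : R) : a < x < b -> \forall y \near x, a < y < b.
Proof.
move=> xab; have nx : \forall y \near x, y \in `]a, b[.
  by apply: near_in_itvoo; rewrite in_itv.
by apply: filterS nx => y; rewrite in_itv.
Qed.

Lemma sub_itvoocc (a b x : R) : a < x < b -> a <= x <= b.
Proof. by move=> /andP[? ?]; rewrite !ltW. Qed.

Lemma caputo_extend (nu T s x : R) (u : R -> R -> R) : 0 < s < T -> 0 <= x <= 1 ->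
  caputo nu (u x) s = (Gamma (1 - nu))^-1 *
    \int[mu]_(r in `]0, s[) (dt_extend T u x r * (s - r) `^ (- nu)).
Proof.
move=> /andP[s0 sT] x01; congr (_ * _); apply: eq_Rintegral => r.
rewrite inE/= in_itv/= => /andP[r0 rs].
by rewrite dt_extend_id ?clamp_id// r0 (lt_trans rs).
Qed.

(** The memory integral is the Caputo derivative without its normalization, hence the factor
    [Gamma (1 - nu)]. *)
Lemma energy_bound_at (nu T al ga c1 s : R) (k f u : R -> R -> R) (m u0 : R -> R) :
  0 < nu < 1 -> 0 < c1 -> al <> 1 -> ga <= 0 -> 0 < s < T ->
  continuous_on2 (`[0, 1] `*` `[0, T]) k ->
  continuous_on2 (`[0, 1] `*` `[0, T]) f ->
  (forall x t : R, 0 <= x <= 1 -> 0 <= t <= T -> c1 <= k x t) ->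
  is_solution nu T al al ga k f m u0 u ->
  continuous (fun x =>
    \int[mu]_(r in `]0, s[) (dt_extend T u x r * (s - r) `^ (- nu))) ->
  \int[mu]_(x in `[0, 1]) (extend T u x s *
    \int[mu]_(r in `]0, s[) (dt_extend T u x r * (s - r) `^ (- nu))) <=
  Gamma (1 - nu) *
   (- (c1 / 2) * (\int[mu]_(x in `[0, 1]) extend T (pdx u) x s ^+ 2)
    + (1 + `|1 - al|^-1) ^+ 2 / c1 *
      (\int[mu]_(x in `[0, 1]) extend T f x s ^+ 2 + m s ^+ 2)).
Proof.
move=> nu01 c10 al1 ga0 sT ck cf kc sol cD.
have G0 : 0 < Gamma (1 - nu) by apply: Gamma_gt0; move: nu01 => /andP[? ?]; apply/andP; split; lra.
have [reg eqn bcv bcf _] := sol.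
have /andP[s0 sT'] := sT.
have sT01 : 0 <= s <= T by exact: sub_itvoocc.
have T0 : 0 <= T by rewrite ltW// (lt_trans s0).
pose D x := (Gamma (1 - nu))^-1 *
  \int[mu]_(r in `]0, s[) (dt_extend T u x r * (s - r) `^ (- nu)).
have cDD : continuous D by move=> x; apply: cvgM; [exact: cvg_cst|exact: cD].
have cw : continuous (extend T u ^~ s) := extend_continuousl T u T0 (reg_cont reg) s.
have cq : continuous (extend T (pdx u) ^~ s) :=
  extend_continuousl T _ T0 (reg_dx_cont reg) s.
have ckk : continuous (extend T k ^~ s) := extend_continuousl T k T0 ck s.
have cff : continuous (extend T f ^~ s) := extend_continuousl T f T0 cf s.
have dw (x : R) : 0 < x < 1 -> is_derive x 1 (extend T u ^~ s) (extend T (pdx u) x s).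
  move=> x01; rewrite extend_id//; last exact: sub_itvoocc.
  have d := reg_dx reg (sub_itvoocc _ _ _ x01) sT01.
  apply: near_eq_is_derive (derive01_interior _ _ x01 d).
  apply: filterS (near_itvoo _ _ _ x01) => y y01; rewrite extend_id//.
  exact: sub_itvoocc.
(* The equation identifies the flux derivative with [D - f], a continuous function, although the
   regularity assumptions give differentiability of the flux only. *)
have dkq (x : R) : 0 < x < 1 -> is_derive x 1
    (fun x => extend T k x s * extend T (pdx u) x s) (D x - extend T f x s).
  move=> x01; have x01' := sub_itvoocc _ _ _ x01.
  have s0T : 0 < s <= T by rewrite s0 ltW.
  have d := reg_flux reg x01 s0T.
  have E : derive1 (flux k u s) x = D x - extend T f x s.
    by rewrite extend_id// /D -(caputo_extend nu T s x u sT x01') eqn//; ring.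
  apply: (@near_eq_is_derive _ _ _ (flux k u s)).
    apply: filterS (near_itvoo _ _ _ x01) => y y01.
    by rewrite /flux !extend_id//; exact: sub_itvoocc.
  by apply: (DeriveDef d); rewrite -derive1E E.
have kc' (x : R) : 0 <= x <= 1 -> c1 <= extend T k x s.
  by move=> x01; rewrite extend_id//; exact: kc.
have i0 : (0 : R) <= (0 : R) <= (1 : R) by rewrite lexx /= ler01.
have i1 : (0 : R) <= (1 : R) <= (1 : R) by rewrite lexx andbT ler01.
have bv : extend T u 0 s = al * extend T u 1 s by rewrite !extend_id// bcv.
have bq : extend T k 1 s * extend T (pdx u) 1 s =
    al * (extend T k 0 s * extend T (pdx u) 0 s) + ga * extend T u 1 s + m s.
  by rewrite !extend_id// bcf.
have := spatial_energy_bound al ga c1 (m s) _ _ _ _ _ al1 ga0 c10 cw cq ckk cDD cff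
  dw dkq kc' bv bq.
rewrite -(ler_pM2l G0); apply: le_trans.
have iwD : mu.-integrable `[0, 1] (EFin \o (fun x => extend T u x s * D x)).
  by apply: continuous_integrable01 => x; apply: cvgM; [exact: cw|exact: cDD].
rewrite -(@RintegralZl _ _ _ mu _ _ _ (measurable_itv _) iwD).
rewrite le_eqVlt; apply/orP; left; apply/eqP; apply: eq_Rintegral => x _.
by rewrite /D mulrCA [X in _ = _ * X]mulrA divff ?gt_eqF// mul1r.
Qed.

End estimate.

Lemma sqnorm0_extend (R : realType) (T t : R) (f : R -> R -> R) : 0 <= t <= T ->
  sqnorm0 (fun x => f x t) =
  \int[lebesgue_measure]_(x in `[0, 1]) extend T f x t ^+ 2.
Proof.
move=> tT; apply: eq_Rintegral => x; rewrite inE/= in_itv/= => x01.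
by rewrite extend_id.
Qed.

Lemma rl_integralE (R : realType) (nu t : R) (g h : R -> R) :
  (forall s, 0 < s < t -> g s = h s) ->
  rl_integral nu g t = (Gamma nu)^-1 *
    \int[lebesgue_measure]_(s in `]0, t[) ((t - s) `^ (nu - 1) * h s).
Proof.
move=> gh; congr (_ * _); apply: eq_Rintegral => s; rewrite inE/= in_itv/= => st.
by rewrite gh.
Qed.

Lemma rl_integral_ge0 (R : realType) (nu t : R) (g : R -> R) :
  0 < nu < 1 -> (forall s, 0 <= g s) -> 0 <= rl_integral nu g t.
Proof.
move=> nu01 g0; rewrite mulr_ge0 ?invr_ge0 ?(ltW (Gamma_gt0 _ nu01))//.
by apply: Rintegral_ge0 => s _; rewrite mulr_ge0 ?powR_ge0.
Qed.

Lemma sqnorm0_ge0 (R : realType) (g : R -> R) : 0 <= sqnorm0 g.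
Proof. by apply: Rintegral_ge0 => x _; exact: sqr_ge0. Qed.

Lemma factor_normalization (R : fieldType) (G1 G2 c l X Y Z : R) : G2 != 0 ->
  G1 * (c * X + l * (Y + Z)) =
  G1 * G2 * (c * (G2^-1 * X) + l * (G2^-1 * Y + G2^-1 * Z)).
Proof. by move=> G20; field. Qed.

Lemma fractional_estimate (R : realType) (nu T al ga c1 t : R) (k f u : R -> R -> R)
    (m u0 : R -> R) :
  0 < nu < 1 -> 0 < c1 -> al <> 1 -> ga <= 0 -> 0 < t <= T ->
  continuous_on2 (`[0, 1] `*` `[0, T]) k ->
  continuous_on2 (`[0, 1] `*` `[0, T]) f ->
  (forall x t : R, 0 <= x <= 1 -> 0 <= t <= T -> c1 <= k x t) ->
  {within `[0, T], continuous m} ->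
  is_solution nu T al al ga k f m u0 u ->
  beta_abel nu / 2 * (sqnorm0 (fun x => u x t) - sqnorm0 u0) <=
  Gamma (1 - nu) * Gamma nu *
   (- (c1 / 2) * rl_integral nu (fun s => sqnorm0 (fun x => pdx u x s)) t
    + (1 + `|1 - al|^-1) ^+ 2 / c1 *
      (rl_integral nu (fun s => sqnorm0 (fun x => f x s)) t
       + rl_integral nu (fun s => m s ^+ 2) t)).
Proof.
move=> nu01 c10 al1 ga0 tT ck cf kc cm sol; have [reg _ _ _ ic] := sol.
have /andP[nu0 nu1] := nu01; have /andP[t0 tT'] := tT.
have T0 : 0 < T := lt_le_trans t0 tT'.
have T0' := ltW T0.
have [h ih uh] := reg_dt_dom reg.
have tT0 : 0 <= t <= T by rewrite ltW.
have i0T : (0 : R) <= (0 : R) <= T by rewrite lexx.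
have [A wA] := extend_bounded T u T0' (reg_cont reg).
have [B qB] := extend_bounded T (pdx u) T0' (reg_dx_cont reg).
have [C fC] := extend_bounded T f T0' cf.
have cpdt := reg_dt_cont reg.
have cm' : continuous (fun s => m (clamp T s)).
  apply: (continuous_within_comp R R R _ m (clamp T) cm (continuous_clamp T T0')) => s.
  by rewrite /= in_itv/=; apply: clamp_itv.
have [N mN] : exists N, forall s, `|m (clamp T s)| <= N.
  have [N mN] := within_bounded _ _ _ cm (segment_compact (a := 0) (b := T)).
  by exists N => s; apply: mN; rewrite /= in_itv/=; apply: clamp_itv.
have [mS SB] := sqnorm_param B _ (extend_continuousl T _ T0' (reg_dx_cont reg))
  (extend_continuousr T _ T0' (reg_dx_cont reg)) qB.
have [mF FC] := sqnorm_param C _ (extend_continuousl T _ T0' cf)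
  (extend_continuousr T _ T0' cf) fC.
pose S s := \int[lebesgue_measure]_(x in `[0, 1]) extend T (pdx u) x s ^+ 2.
pose F s := \int[lebesgue_measure]_(x in `[0, 1]) extend T f x s ^+ 2.
pose m2 s := m (clamp T s) ^+ 2.
have iS := integrable_powRBr_bounded nu t _ S nu0 mS SB.
have iF := integrable_powRBr_bounded nu t _ F nu0 mF FC.
have im : lebesgue_measure.-integrable `]0, t[
    (EFin \o (fun s => (t - s) `^ (nu - 1) * m2 s)).
  apply: (integrable_powRBr_bounded nu t (N ^+ 2) m2 nu0).
    by apply: continuous_measurable_fun => s; apply: cvgM; exact: cm'.
  move=> s; rewrite /m2 normrX lerXn2r ?nnegrE//.
  exact: le_trans (normr_ge0 _) (mN 0).
set L := (1 + `|1 - al|^-1) ^+ 2 / c1.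
(* The right-hand side of the spatial estimate, written with clamped data so as to be defined and
   measurable for all [s]. *)
pose E s := Gamma (1 - nu) * (- (c1 / 2) * S s + L * (F s + m2 s)).
have stT s : 0 < s < t -> 0 <= s <= T.
  by move=> /andP[s0 st]; rewrite ltW//= (le_trans (ltW st)).
have p_dom (x r : R) : 0 < r < T -> `|dt_extend T u x r| <= h r.
  move=> rT; rewrite dt_extend_id//; apply: uh => //; exact: clamp_itv.
have w_der (x r : R) : 0 < r < T -> is_derive r 1 (extend T u x) (dt_extend T u x r).
  move=> rT; rewrite dt_extend_id//.
  have d := reg_dt reg (clamp_itv 1 x ler01) rT.
  apply: (@near_eq_is_derive _ _ _ (u (clamp 1 x))).
    apply: filterS (near_itvoo _ _ _ rT) => y yT.
    by rewrite /extend (clamp_id T y)//; exact: sub_itvoocc.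
  by apply: (DeriveDef d); rewrite /pdt derive1E.
have wE s : 0 < s < T -> \int[lebesgue_measure]_(x in `[0, 1]) (extend T u x s *
    \int[lebesgue_measure]_(r in `]0, s[) (dt_extend T u x r * (s - r) `^ (- nu)))
    <= E s.
  move=> sT; rewrite /E /m2 (clamp_id T s); last exact: sub_itvoocc.
  apply: (energy_bound_at nu T al ga c1 s k f u m u0) => //.
  apply: (continuous_memory nu T (dt_extend T u) h) => //.
  - exact: dt_extend_continuousl.
  - exact: dt_extend_measurable.
  - exact: dt_extend_locally_bounded.
have iFm := EFin_integrableD _ _ (@lebesgue_measure R) _ _ _ (measurable_itv _) iF im.
have iLF := EFin_integrableZl _ _ (@lebesgue_measure R) _ L _ (measurable_itv _) iFm.
have icS := EFin_integrableZl _ _ (@lebesgue_measure R) _ (- (c1 / 2)) _ (measurable_itv _) iS.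
have iSF := EFin_integrableD _ _ (@lebesgue_measure R) _ _ _ (measurable_itv _) icS iLF.
have KE : (fun s => (t - s) `^ (nu - 1) * E s) = (fun s => Gamma (1 - nu) *
    (- (c1 / 2) * ((t - s) `^ (nu - 1) * S s)
     + L * ((t - s) `^ (nu - 1) * F s + (t - s) `^ (nu - 1) * m2 s))).
  by apply/funext => s; rewrite /E; ring.
have iE : lebesgue_measure.-integrable `]0, t[
    (EFin \o (fun s => (t - s) `^ (nu - 1) * E s)).
  by rewrite KE; exact: EFin_integrableZl.
have := fractional_energy_le nu T A (extend T u) (dt_extend T u) h nu01
  (extend_continuousl T u T0' (reg_cont reg)) (extend_continuousr T u T0' (reg_cont reg))
  wA (dt_extend_continuousl T u cpdt) (dt_extend_measurable T u cpdt)
  (dt_extend_continuousr T u cpdt) w_der ih p_dom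
  (dt_extend_locally_bounded T u cpdt) E t tT wE iE.
rewrite KE (@RintegralZl _ _ _ lebesgue_measure _ _ _ (measurable_itv _) iSF).
rewrite (@RintegralD _ _ _ lebesgue_measure _ _ _ (measurable_itv _) icS iLF).
rewrite (@RintegralZl _ _ _ lebesgue_measure _ _ _ (measurable_itv _) iS).
rewrite (@RintegralZl _ _ _ lebesgue_measure _ _ _ (measurable_itv _) iFm).
rewrite (@RintegralD _ _ _ lebesgue_measure _ _ _ (measurable_itv _) iF im).
rewrite -(sqnorm0_extend R T t u tT0) -(sqnorm0_extend R T 0 u i0T).
have -> : sqnorm0 (fun x => u x 0) = sqnorm0 u0.
  by apply: eq_Rintegral => x; rewrite inE/= in_itv/= => x01; rewrite ic.
rewrite (rl_integralE R nu t _ S); last by move=> s /stT; exact: sqnorm0_extend.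
rewrite (rl_integralE R nu t _ F); last by move=> s /stT; exact: sqnorm0_extend.
rewrite (rl_integralE R nu t _ m2); last by move=> s /stT sT; rewrite /m2 clamp_id.
have G0 := gt_eqF (Gamma_gt0 nu nu01).
move=> /le_trans; apply; rewrite le_eqVlt; apply/orP; left; apply/eqP.
by apply: factor_normalization; rewrite G0.
Qed.

(** [e] lies below both left-hand weights; the nonnegative slack [a * Y + d * V0] lets the single
    factor [a + d] multiply all the data. *)
Lemma absorb_weights (R : realFieldType) (a b d e V S Y V0 : R) :
  e <= a -> e <= b -> 0 <= a -> 0 <= d -> 0 <= V -> 0 <= S -> 0 <= Y -> 0 <= V0 ->
  a * (V - V0) <= - b * S + d * Y -> V * e + S * e <= (a + d) * (Y + V0).
Proof.
move=> ea eb a0 d0 V0_ S0 Y0 V00 H.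
have h1 : V * e <= V * a by rewrite ler_wpM2l.
have h2 : S * e <= S * b by rewrite ler_wpM2l.
have h3 : 0 <= a * Y by rewrite mulr_ge0.
have h4 : 0 <= d * V0 by rewrite mulr_ge0.
lra.
Qed.

Theorem theorem1 (R : realType) (nu c1 c2 alpha beta gamma : R)
    (hnu : 0 < nu < 1) (hc1 : 0 < c1)
    (hab : alpha = beta) (hb : beta <> 1) (hgamma : gamma <= 0) :
  exists M : R, 0 < M /\
    forall (T : R) (k f : R -> R -> R) (mu u0 : R -> R) (u : R -> R -> R),
      0 < T ->
      continuous_on2 (`[0, 1] `*` `[0, T]) k ->
      continuous_on2 (`[0, 1] `*` `[0, T]) f ->
      (forall x t : R, 0 <= x <= 1 -> 0 <= t <= T -> c1 <= k x t <= c2) ->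
      (forall x t : R, 0 <= x <= 1 -> 0 <= t <= T -> k x t = k (1 - x) t) ->
      {within `[0, T], continuous mu} ->
      is_solution nu T alpha beta gamma k f mu u0 u ->
      forall t : R, 0 <= t <= T ->
        sqnorm0 (fun x => u x t)
          + rl_integral nu (fun s => sqnorm0 (fun x => pdx u x s)) t
        <= M * (rl_integral nu (fun s => sqnorm0 (fun x => f x s)) t
                + rl_integral nu (fun s => mu s ^+ 2) t
                + sqnorm0 u0).
Proof.
subst alpha; have /andP[nu0 nu1] := hnu.
pose a := beta_abel nu / 2.
pose g := Gamma (1 - nu) * Gamma nu.
pose b := g * (c1 / 2).
pose d := g * ((1 + `|1 - beta|^-1) ^+ 2 / c1).
have a0 : 0 < a by rewrite divr_gt0// beta_abel_gt0.
have g0 : 0 < g.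
  by rewrite mulr_gt0 ?Gamma_gt0//; apply/andP; split; lra.
have b0 : 0 < b by rewrite mulr_gt0// divr_gt0.
have d0 : 0 <= d by rewrite mulr_ge0 ?(ltW g0)// divr_ge0 ?sqr_ge0// ltW.
pose e := Num.min a b.
have e0 : 0 < e by rewrite lt_min a0.
have ea : e <= a by rewrite ge_min lexx.
have eb : e <= b by rewrite ge_min lexx orbT.
(* [a] and [b] are the coefficients of the norm of [u] and of the integrated norm of [u_x], [d] that
   of the data. All depend on [nu], [c1] and [beta] alone, and are fixed before [T] is
   introduced. *)
exists ((a + d) / e); split; first by rewrite divr_gt0// ltr_pwDl.
move=> T k f mu u0 u T0 ck cf kc _ cmu sol t /andP[t0 tT].
set V := sqnorm0 (fun x => u x t); set rS := rl_integral nu (fun s => sqnorm0 _) t.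
set rF := rl_integral nu (fun s => sqnorm0 (fun x => f x s)) t.
set rm := rl_integral nu (fun s => mu s ^+ 2) t; set V0 := sqnorm0 u0.
have V00 : 0 <= V0 by exact: sqnorm0_ge0.
have V_ge0 : 0 <= V by exact: sqnorm0_ge0.
have rS0 : 0 <= rS by apply: rl_integral_ge0 => // s; exact: sqnorm0_ge0.
have rF0 : 0 <= rF by apply: rl_integral_ge0 => // s; exact: sqnorm0_ge0.
have rm0 : 0 <= rm by apply: rl_integral_ge0 => // s; exact: sqr_ge0.
suff H : a * (V - V0) <= - b * rS + d * (rF + rm).
  rewrite mulrAC ler_pdivlMr// mulrDl.
  by apply: (absorb_weights R a b d e V rS (rF + rm) V0) => //; [exact: ltW|exact: addr_ge0].
(* At [t = 0] the fractional integrals run over an empty interval and vanish, and the claim reduces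
   to the initial condition. *)
move: t0; rewrite le_eqVlt => /predU1P[t0|t0].
  have rl0 w : rl_integral nu w t = 0.
    by rewrite /rl_integral -t0 set_itv_ge ?bnd_simp// Rintegral_set0 mulr0.
  rewrite /rS /rF /rm !rl0 addr0 !mulr0 addr0 (_ : V = V0) ?subrr ?mulr0//.
  have [_ _ _ _ ic] := sol.
  by apply: eq_Rintegral => x; rewrite inE/= in_itv/= => x01; rewrite -t0 ic.
have kc1 x s : 0 <= x <= 1 -> 0 <= s <= T -> c1 <= k x s.
  by move=> x01 sT; have /andP[] := kc x s x01 sT.
have tT' : 0 < t <= T by rewrite t0.
have := fractional_estimate R nu T beta gamma c1 t k f u mu u0 hnu hc1 hb hgamma tT'
  ck cf kc1 cmu sol.
move=> /le_trans; apply; rewrite le_eqVlt; apply/orP; left; apply/eqP.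
by rewrite /b /d /g -/rS -/rF -/rm; ring.
Qed.
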